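(* For any (classical) knot $K$, $$\mathrm{u}_{\mathrm{v}}(K)\le \mathrm{tr}(K).$$
   Context: A shadow is a planar knot diagram in which the over/under information of all crossings is undetermined; such undetermined crossings are called precrossings. Resolving a precrossing means assigning over/under information to it. The trivializing number $\mathrm{tr}(S)$ of a shadow $S$ is the minimum number of precrossings which must be (suitably) resolved so that the result is necessarily unknotted, i.e. every way of resolving the remaining precrossings gives a diagram of the unknot. For a knot $K$, $\mathrm{tr}(K)=\min_{S}\mathrm{tr}(S)$, where $S$ ranges over the shadows of all diagrams of $K$. A virtual knot diagram is a generic closed curve in the plane each of whose double points is either a classical crossing (over/under information given) or a virtual crossing (circled, no over/under information). Such diagrams are considered up to planar isotopy, the classical Reidemeister moves and the virtual Reidemeister moves; equivalently, planar isotopy, the classical Reidemeister moves and the detour move (a strand containing no classical crossings may be replaced by any other strand with the same endpoints and no classical crossings, all new double points being virtual). The unknot is the class of the crossingless circle. The virtual unknotting number $\mathrm{u}_{\mathrm{v}}(D)$ of a diagram $D$ is the minimum number of classical crossings that must be made virtual so that the resulting diagram is a diagram of the unknot, and $\mathrm{u}_{\mathrm{v}}(K)=\min_D \mathrm{u}_{\mathrm{v}}(D)$ over all diagrams $D$ of $K$. *)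

(* Defs.v *)
From Stdlib Require Import Relations.
From mathcomp Require Import all_boot.
From mathcomp Require Import boolp.

Set Implicit Arguments.
Unset Strict Implicit.
Unset Printing Implicit Defensive.

(** * Plane diagrams

  A plane diagram, up to planar isotopy, is a 4-regular plane graph traversed
  by one closed curve.  The curve is cut at a base point lying on an arc of the
  boundary of the unbounded face, it is oriented, and the passages through the
  double points are listed in order.  Both choices (base point, orientation)
  are quotiented out by [same_diagram] below.  Virtual crossings are genuine
  vertices of the graph, just like classical ones.

  [Pre] is the kind of the precrossings of a shadow. *)

Variant crossing_kind := Over | Under | Virtual | Pre.

Definition is_classical (k : crossing_kind) :=
  match k with Over | Under => true | _ => false end.
Definition is_pre (k : crossing_kind) := if k is Pre then true else false.
Definition is_virtual (k : crossing_kind) := if k is Virtual then true else false.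

(** Kind of the other passage through the same double point. *)
Definition mate (k : crossing_kind) :=
  match k with Over => Under | Under => Over | Virtual => Virtual | Pre => Pre end.

(** [from_right p] holds when, seen by the traveller at [p], the other strand
    crosses from right to left.  It determines the cyclic order of the four
    half-edges at the double point; for an over-passage it is the statement
    that the crossing is positive. *)
Record passage := Passage
  { label : nat; kind : crossing_kind; from_right : bool }.

(** The unbounded face is to the left of the base arc if [outer_left], and to
    its right otherwise.  The empty code is the crossingless circle. *)
Record diagram := Diagram { code : seq passage; outer_left : bool }.

Definition wf_code (w : seq passage) : Prop :=
  forall c, let s := [seq p <- w | label p == c] in
    s = [::] \/
    exists k d, s = [:: Passage c k d; Passage c (mate k) (~~ d)].

Definition passage_at (w : seq passage) (i : 'I_(size w)) : passage :=
  tnth (in_tuple w) i.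

(** Position of the other passage through the same double point. *)
Definition other (w : seq passage) (i : 'I_(size w)) : 'I_(size w) :=
  odflt i [pick j | (j != i) && (label (passage_at j) == label (passage_at i))].

(** Arc [i] arrives at position [i] (so arc 0 is the base arc).  The dart
    [(i, b)] is arc [i] travelled forwards if [b], backwards otherwise; it
    represents the face on its left.  [face_next] turns left at the end of the
    dart, so that its orbits are the faces. *)
Definition face_next (w : seq passage) (x : 'I_(size w) * bool) :
    'I_(size w) * bool :=
  let: (i, b) := x in
  let k := if b then i else ord_pred i in
  let j := other k in
  if from_right (passage_at k) == b then (ordS j, true) else (j, false).

(** Euler's formula V - E + F = 2, with E = [size w] and V = E / 2 (the curve
    makes the graph connected). *)
Definition planar_code (w : seq passage) : Prop :=
  w = [::] \/ fcard (@face_next w) predT = (size w)./2 + 2.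

Definition plane_diagram (D : diagram) : Prop :=
  wf_code (code D) /\ planar_code (code D).

Definition classical_diagram (D : diagram) : Prop :=
  plane_diagram D /\ all (fun p => is_classical (kind p)) (code D).

Definition virtual_diagram (D : diagram) : Prop :=
  plane_diagram D /\ all (fun p => ~~ is_pre (kind p)) (code D).

(** * Moves *)

Definition relabel (f : nat -> nat) (p : passage) : passage :=
  Passage (f (label p)) (kind p) (from_right p).

(** Two codes of the same (unoriented) plane diagram: change of the labels, of
    the base point along the boundary of the unbounded face, of the
    orientation. *)
Inductive same_diagram : diagram -> diagram -> Prop :=
| same_relabel f w b : injective f ->
    same_diagram (Diagram w b) (Diagram (map (relabel f) w) b)
| same_base w b b' (i0 i : 'I_(size w)) : i0 = 0 :> nat ->
    fconnect (@face_next w) (i0, b) (i, b') ->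
    same_diagram (Diagram w b) (Diagram (rot i w) b')
| same_reverse w b :
    same_diagram (Diagram w b) (Diagram (rev w) (~~ b)).

Definition level (o : bool) : crossing_kind := if o then Over else Under.

Definition orient (e : bool) (s : seq passage) : seq passage :=
  if e then s else rev s.

(** Classical Reidemeister moves.  The surrounding code is arbitrary; both sides
    are required to be plane diagrams where the moves are used.

    [R2]: the first strand is over both crossings or under both; the opposite
    directions at [a] and [b] make the two arcs between [a] and [b] bound a
    face; [e] tells whether the strands run in the same direction.

    [R3]: crossings [a], [b], [c] are those of the pairs of strands (1,2),
    (1,3), (2,3).  Each [e_i] tells in which order strand [i] meets its two
    crossings.  The directions [x (+) e_i] are exactly those for which the
    three arcs bound a triangular face.  Strand 1 is over 2 if [la], over 3 if
    [lb], and 2 is over 3 if [lc]; the side condition says that this relation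
    has no cycle. *)
Inductive reidemeister : diagram -> diagram -> Prop :=
| R1 b x y a l d :
    reidemeister
      (Diagram (x ++ y) b)
      (Diagram (x ++ [:: Passage a (level l) d;
                         Passage a (level (~~ l)) (~~ d)] ++ y) b)
| R2 b x y z a a' l d e :
    reidemeister
      (Diagram (x ++ y ++ z) b)
      (Diagram (x ++ [:: Passage a (level l) d; Passage a' (level l) (~~ d)]
                  ++ y ++ orient e [:: Passage a (level (~~ l)) (~~ d);
                                       Passage a' (level (~~ l)) d] ++ z) b)
| R3 out x0 x1 x2 x3 a b c x e1 e2 e3 la lb lc :
    (la == lc) ==> (lb == la) ->
    let da := x (+) e3 in let db := x (+) e2 in let dc := x (+) e1 in
    let s1 := [:: Passage a (level la) da; Passage b (level lb) db] in
    let s2 := [:: Passage a (level (~~ la)) (~~ da);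
                  Passage c (level lc) dc] in
    let s3 := [:: Passage b (level (~~ lb)) (~~ db);
                  Passage c (level (~~ lc)) (~~ dc)] in
    reidemeister
      (Diagram (x0 ++ orient e1 s1 ++ x1 ++ orient e2 s2 ++ x2
                   ++ orient e3 s3 ++ x3) out)
      (Diagram (x0 ++ orient (~~ e1) s1 ++ x1 ++ orient (~~ e2) s2 ++ x2
                   ++ orient (~~ e3) s3 ++ x3) out).

(** The rest of a code when all double points of the strand [s] are erased. *)
Definition erase (s w : seq passage) : seq passage :=
  [seq p <- w | label p \notin map label s].

(** The strand [s] has no classical crossing and is replaced by [s']; outside
    of the strands the two diagrams are the same plane curve, with the strands
    attached at the same place. *)
Inductive detour : diagram -> diagram -> Prop :=
| Detour b x s y x' s' y' :
    all (fun p => is_virtual (kind p)) s ->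
    all (fun p => is_virtual (kind p)) s' ->
    erase s x = erase s' x' -> erase s y = erase s' y' ->
    detour (Diagram (x ++ s ++ y) b) (Diagram (x' ++ s' ++ y') b).

(** Planar isotopy and classical Reidemeister moves. *)
Definition classical_equiv : diagram -> diagram -> Prop :=
  clos_refl_sym_trans diagram (fun D D' =>
    [/\ classical_diagram D, classical_diagram D'
      & same_diagram D D' \/ reidemeister D D']).

(** Planar isotopy, classical Reidemeister moves and the detour move. *)
Definition virtual_equiv : diagram -> diagram -> Prop :=
  clos_refl_sym_trans diagram (fun D D' =>
    [/\ virtual_diagram D, virtual_diagram D'
      & [\/ same_diagram D D', reidemeister D D' | detour D D']]).

(** The two values of [b] are the two orientations of the circle. *)
Definition circle (b : bool) : diagram := Diagram [::] b.

Definition classical_unknot (D : diagram) : Prop :=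
  exists b, classical_equiv (circle b) D.

Definition virtual_unknot (D : diagram) : Prop :=
  exists b, virtual_equiv (circle b) D.

(** Classical knots, and the virtual knots they define, as classes of
    diagrams. *)
Definition classical_knot (K : diagram -> Prop) : Prop :=
  exists2 D, classical_diagram D & forall D', K D' <-> classical_equiv D D'.

Definition as_virtual (K : diagram -> Prop) (D' : diagram) : Prop :=
  exists2 D, K D & virtual_equiv D D'.

(** * Minima

  Minimum of a set of natural numbers; [None] stands for +oo, the minimum of
  the empty set. *)
Definition minimum (P : nat -> Prop) : option nat :=
  if pselect (exists n, `[< P n >]) is left h then Some (ex_minn h) else None.

Definition le_inf (m n : option nat) : Prop :=
  match m, n with
  | _, None => True
  | None, Some _ => False
  | Some m, Some n => m <= n
  end.

(** * Trivializing number *)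

Definition shadow (D : diagram) : diagram :=
  Diagram [seq Passage (label p) Pre (from_right p) | p <- code D]
          (outer_left D).

Definition precrossings (D : diagram) : seq nat :=
  undup [seq label p | p <- code D & is_pre (kind p)].

(** Resolve the precrossings in [A]: the crossing [c] becomes positive if
    [sigma c] and negative otherwise. *)
Definition resolve (A : seq nat) (sigma : nat -> bool) (D : diagram) : diagram :=
  Diagram
    [seq if is_pre (kind p) && (label p \in A)
         then Passage (label p) (level (sigma (label p) == from_right p))
                      (from_right p)
         else p | p <- code D]
    (outer_left D).

(** The precrossings of [P] may be resolved in any way: the result is
    unknotted. *)
Definition necessarily_unknotted (P : diagram) : Prop :=
  forall tau, classical_unknot (resolve (precrossings P) tau P).

Definition tr_shadow (S : diagram) : option nat :=
  minimum (fun n => exists (A : seq nat) (sigma : nat -> bool),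
    [/\ uniq A, {subset A <= precrossings S}, size A = n
      & necessarily_unknotted (resolve A sigma S)]).

Definition tr (K : diagram -> Prop) : option nat :=
  minimum (fun n => exists2 D, K D & tr_shadow (shadow D) = Some n).

(** * Virtual unknotting number *)

Definition classical_crossings (D : diagram) : seq nat :=
  undup [seq label p | p <- code D & is_classical (kind p)].

Definition virtualize (A : seq nat) (D : diagram) : diagram :=
  Diagram
    [seq if label p \in A then Passage (label p) Virtual (from_right p) else p
    | p <- code D]
    (outer_left D).

Definition uv_diagram (D : diagram) : option nat :=
  minimum (fun n => exists A : seq nat,
    [/\ uniq A, {subset A <= classical_crossings D}, size A = n
      & virtual_unknot (virtualize A D)]).

Definition uv (V : diagram -> Prop) : option nat :=
  minimum (fun n => exists2 D, V D & uv_diagram D = Some n).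

(* Main.v *)
(** By Euler's formula, a code is planar iff its face boundaries span all the
    mod 2 cycles of its 4-regular graph: the two spaces have dimensions F - 1 and
    E - V + 1.  This homological criterion passes to the diagram obtained by
    deleting a closed subloop, and, applied to the cycle of all arcs, it gives
    Gauss's parity condition (every chord meets an even number of chords).

    Thanks to the latter, the Arf invariant, i.e. the Polyak-Viro count modulo 2
    of the interlaced pairs of chords of a given over/under type, is invariant
    under change of base point, hence is a knot invariant vanishing on the unknot.
    Its second difference under the changes of two crossings is 1 when their
    chords are interlaced.  So, if resolving [A] makes a shadow necessarily
    unknotted, the chords outside [A] are pairwise not interlaced.

    After virtualizing [A], an innermost classical chord bounds a loop with
    only virtual crossings; a detour shrinks the loop to a kink, which a first
    Reidemeister move removes.  By induction no classical crossing remains, and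
    a last detour gives the circle. *)
From Stdlib Require Import Relations.
From mathcomp Require Import all_boot all_algebra zify.
From mathcomp Require Import boolp.
Require Import Defs.

Set Implicit Arguments.
Unset Strict Implicit.
Unset Printing Implicit Defensive.

Import GRing.Theory.

(** * The homological criterion of planarity *)

(* For the classes of [f] joined by the edges [(a e, b e)] into a connected graph,
   the left kernel of the incidence matrix is spanned by the all-one vector. *)
Lemma rank_incidence (T : finType) (f : T -> T) (n : nat) (a b : 'I_n -> T) :
  injective f ->
  (forall u : T -> bool, (forall x, u (f x) = u x) ->
     (forall e, u (a e) = u (b e)) -> forall x y, u x = u y) ->
  T ->
  exists M : 'M[bool]_(fcard f predT, n),
    (\rank M).+1 = fcard f predT /\
    forall g : 'rV_n, (g <= M)%MS <->
      exists2 u : T -> bool, (forall x, u (f x) = u x) &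
        forall e, g 0%R e = u (a e) (+) u (b e).
Proof.
move=> injf conn t0; rewrite /n_comp_mem.
set X := [predI froots f & predT].
have symf := fconnect_sym injf.
have rX x : froot f x \in X by rewrite inE andbT; apply: (roots_root symf x).
pose rk x := enum_rank_in (rX t0) (froot f x).
have rkE x y : rk x = rk y -> froot f x = froot f y.
  by move/(congr1 enum_val); rewrite !enum_rankK_in.
have rkf x : rk (f x) = rk x.
  by rewrite /rk; congr enum_rank_in; apply/eqP; rewrite root_connect // symf fconnect1.
have rk_surj r : exists x, rk x = r.
  exists (enum_val r); rewrite /rk.
  have := enum_valP r; rewrite inE andbT => /eqP ->.
  by rewrite enum_valK_in.
have lift_rk (u : T -> bool) : (forall x, u (f x) = u x) ->
    exists v : 'rV[bool]_#|X|, forall x, u x = v 0%R (rk x).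
  move=> uf; exists (\row_r u (enum_val r))%R => x; rewrite mxE enum_rankK_in //.
  have /iter_findex <- : fconnect f x (froot f x) by apply: connect_root.
  by elim: (findex _ _ _) => //= m IH; rewrite uf.
(* [bool] is the field with two elements: its addition is [(+)] and its product [&&], so an edge
   with both ends in one class gives a zero column. *)
pose M : 'M[bool]_(#|X|, n) := (\matrix_(r, e) ((r == rk (a e)) (+) (r == rk (b e))))%R.
have ME (v : 'rV_#|X|) e : (v *m M)%R 0%R e = v 0%R (rk (a e)) (+) v 0%R (rk (b e)).
  rewrite mxE.
  have sum1 s : (\sum_i (v 0 i * (i == s)))%R = v 0%R s.
    rewrite (bigD1 s) //= eqxx big1 => [|i /negbTE ->]; last exact: (andbF (v _ _)).
    exact: (etrans (addbF _) (andbT _)).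
  rewrite -(sum1 (rk (a e))) -(sum1 (rk (b e))) -[RHS]big_split /=.
  by apply: eq_bigr => i _; rewrite mxE -[RHS]mulrDr.
exists M; split; last first.
  move=> g; split.
    case/submxP=> v ->; exists (fun x => v 0%R (rk x)) => [x|e]; last exact: ME.
    by rewrite rkf.
  case=> u uf gE; have [v vE] := lift_rk u uf.
  suff -> : g = (v *m M)%R by apply: submxMl.
  by apply/rowP => e; rewrite ME -!vE.
pose c : 'rV[bool]_#|X| := const_mx true.
have cE : (kermx M :=: c)%MS.
  apply/eqmxP/andP; split; last first.
    by apply/sub_kermxP/rowP => e; rewrite ME !mxE.
  apply/rV_subP => v /sub_kermxP v0.
  have vc x y : v 0%R (rk x) = v 0%R (rk y).
    apply: (conn (fun x => v 0%R (rk x))) => [z|e]; first by rewrite rkf.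
    move: (ME v e); rewrite v0 mxE => /esym.
    by case: (v _ _); case: (v _ _).
  have -> : v = (v 0 (rk t0) *: c)%R; last by apply: scalemx_sub.
  apply/rowP => r; have [x <-] := rk_surj r.
  by rewrite !mxE (vc x t0); apply/esym; apply: (andbT (v _ _)).
have := mxrank_ker M; rewrite cE rank_rV.
have -> : c != 0%R.
  by apply/eqP => /rowP /(_ (rk t0)); rewrite !mxE.
have := rank_leq_row M.
rewrite /=; lia.
Qed.

(** * Positions of a code, partner positions and the face permutation *)

Definition p0 := Passage 0 Virtual true.

Definition lab w i := label (nth p0 w i).
Definition dir w i := from_right (nth p0 w i).

Lemma mateK : involutive mate. Proof. by case. Qed.

(** Positional form of [wf_code]: the increasing list [I] of the positions with the label of [k] has
    exactly two elements. *)
Lemma wf_pos w k : wf_code w -> k < size w ->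
  exists j, [/\ j < size w, j != k & [/\ lab w j = lab w k, dir w j = ~~ dir w k,
    kind (nth p0 w j) = mate (kind (nth p0 w k)) &
    forall m, m < size w -> lab w m = lab w k -> (m == k) || (m == j)]].
Proof.
move=> wfw ltk; set c := lab w k; have := wfw c.
set I := [seq i <- iota 0 (size w) | lab w i == c].
have -> : [seq p <- w | label p == c] = [seq nth p0 w i | i <- I].
  by rewrite -[in LHS](mkseq_nth p0 w) /mkseq filter_map.
have memI i : (i \in I) = (i < size w) && (lab w i == c).
  by rewrite mem_filter mem_iota /= add0n andbC.
have uI : uniq I by rewrite filter_uniq ?iota_uniq.
have kI : k \in I by rewrite memI ltk eqxx.
move: I memI uI kI => [|i [|j [|? ?]]] //= memI uI kI; case=> // -[kd [d]] //.
move=> [Ei Ej].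
have [lti /eqP li] := andP (etrans (esym (memI i)) (mem_head _ _)).
have [ltj /eqP lj] : j < size w /\ lab w j == c.
  by apply/andP; rewrite -memI !inE eqxx orbT.
have nij : i != j by move: uI; rewrite inE andbT.
have all2 m : m < size w -> lab w m = c -> (m == i) || (m == j).
  by move=> ltm lm; have := memI m; rewrite ltm lm eqxx !inE.
move: kI; rewrite !inE => /orP[] /eqP ->.
  exists j; split; rewrite ?(eq_sym j) //; rewrite /dir Ei Ej; split => //.
exists i; split => //; rewrite /dir Ei Ej /= mateK negbK li; split => //.
by move=> m ltm /(all2 _ ltm); rewrite orbC.
Qed.

Section Other.
Variables (w : seq passage) (wfw : wf_code w).
Implicit Types i k : 'I_(size w).

Lemma passage_atE i : passage_at i = nth p0 w i.
Proof. exact: tnth_nth. Qed.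

Lemma otherP k : [/\ other k != k, lab w (other k) = lab w k,
  dir w (other k) = ~~ dir w k &
  forall m, m < size w -> lab w m = lab w k -> (m == k) || (m == other k)].
Proof.
have [j [ltj njk [lj dj _ uj]]] := wf_pos wfw (ltn_ord k).
suff -> : other k = Ordinal ltj by split.
rewrite /other; case: pickP => [i /=|/(_ (Ordinal ltj))].
  rewrite !passage_atE => /andP[nik /eqP li].
  have := uj i (ltn_ord i) li; rewrite (negbTE (nik : val i != k)) /= => /eqP ij.
  exact: val_inj.
by rewrite !passage_atE -/(lab w j) -/(lab w k) lj eqxx andbT -val_eqE /= njk.
Qed.

Lemma otherK : involutive (@other w).
Proof.
move=> k; have [nk lk _ _] := otherP k; have [no lo _ _] := otherP (other k).
have [_ _ _ /(_ (other (other k)) (ltn_ord _))] := otherP k.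
by rewrite lo lk => /(_ erefl); rewrite !val_eqE (negbTE no) orbF => /eqP.
Qed.

(** The Boolean of the image tells which branch was taken; the branch gives back the end [k] of the
    dart, and the direction at [k] then gives back [b]. *)
Lemma face_next_inj : injective (@face_next w).
Proof.
have oI := inv_inj otherK.
have sI : injective (@ordS (size w)) by apply: can_inj (@ordSK _).
have pI : injective (@ord_pred (size w)) by apply: can_inj (@ord_predK _).
move=> [i b] [i' b']; rewrite /face_next !passage_atE.
set k := if b then i else _; set k' := if b' then i' else _.
have fin : k = k' -> b = b' -> (i, b) = (i', b').
  by rewrite /k /k' => kk bb; subst b'; case: b kk {k k'} => [|/pI] ->.
case: ifP => ci; case: ifP => ci' //.
  move=> /(congr1 fst)/sI/oI kk; apply: fin => //.
  by move: ci ci'; rewrite kk => /eqP <- /eqP <-.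
move=> /(congr1 fst)/oI kk; apply: fin => //.
by move: ci ci'; rewrite kk; case: (from_right _); case: (b); case: (b').
Qed.

(** The four equalities are the corners of one double point, one for each dart arriving there.
    Naming the double point by its passage with [dir] true treats each of them once. *)
Lemma face_nextE (u : 'I_(size w) * bool -> bool) :
  (forall x, u (face_next x) = u x) <->
  forall k, dir w k ->
    [/\ u (k, true) = u (ordS (other k), true),
        u (ordS k, false) = u (other k, false),
        u (other k, true) = u (k, false) &
        u (ordS (other k), false) = u (ordS k, true)].
Proof.
split=> [uf k dk|uk [i b]].
  have [_ _ dj _] := otherP k; rewrite dk in dj.
  have := uf (k, true); have := uf (ordS k, false).
  have := uf (other k, true); have := uf (ordS (other k), false).
  by rewrite /face_next !ordSK !passage_atE -!/(dir _ _) dj dk otherK /=.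
have step k : if dir w k then u (k, true) = u (ordS (other k), true) /\
        u (ordS k, false) = u (other k, false) else
        u (k, true) = u (other k, false) /\
        u (ordS k, false) = u (ordS (other k), true).
  case: ifP => dk; first by have [] := uk k dk.
  have [_ _ dj _] := otherP k; rewrite dk in dj.
  by have [] := uk _ dj; rewrite otherK.
rewrite /face_next passage_atE; case: b.
  by have := step i; rewrite /dir; case: ifP => di [-> _].
have := step (ord_pred i).
by rewrite ord_predK /dir; case: ifP => di [_ ->].
Qed.

End Other.

(* Arcs are numbered by [nat], arc [size w] being arc 0; the condition at a
   double point says that [g] is a cycle mod 2. *)
Definition flow w (g : nat -> bool) :=
  g (size w) = g 0 /\
  forall k j, k < size w -> j < size w -> k != j -> lab w k = lab w j ->
    g k (+) g k.+1 = g j (+) g j.+1.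

(* [L i] is the colour of the face to the left of arc [i], and [L i (+) g i] that
   of the face to its right; these are the equalities at the four corners. *)
Definition face_coloring w (g L : nat -> bool) :=
  L (size w) = L 0 /\
  forall k j, k < size w -> j < size w -> k != j -> lab w k = lab w j -> dir w k ->
    [/\ L j.+1 = L k, L k.+1 = L k (+) g j.+1 & L j = L k (+) g k].

(** The homological form of planarity: every mod 2 cycle separates the faces into two colours. *)
Definition bounding w := forall g, flow w g -> exists L, face_coloring w g L.

(** * Euler's formula as an equality of ranks *)

Definition ord_flow w (g : 'I_(size w) -> bool) :=
  forall k, g k (+) g (ordS k) = g (other k) (+) g (ordS (other k)).

Definition ord_bounding w := forall g, ord_flow g ->
  exists2 u : 'I_(size w) * bool -> bool, forall x, u (face_next x) = u x &
    forall e, g e = u (e, true) (+) u (e, false).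

(** The terms cancel in pairs [x], [s x]; [P] selects one element of each pair by its rank. *)
Lemma sum_involution (T : finType) (s : T -> T) (F : T -> bool) :
  involutive s -> (forall x, s x != x) -> (forall x, F (s x) = F x) ->
  (\sum_x F x)%R = false.
Proof.
move=> sK sN Fs.
pose P x := enum_rank x < enum_rank (s x).
rewrite (bigID P) /= [X in (_ + X)%R](_ : _ = \sum_(x | P x) F x)%R; first exact: addbb.
rewrite (reindex_inj (inv_inj sK)) /=; apply: eq_big => [x|x _]; last exact: Fs.
rewrite /P sK -leqNgt leq_eqVlt.
by rewrite (inj_eq val_inj) (inj_eq enum_rank_inj) eq_sym (negbTE (sN x)).
Qed.

Section Planar.
Variables (w : seq passage) (wfw : wf_code w).

(** This is E = 2V: the orbits of [other] are the double points, each with two passages. *)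
Lemma fcard_other : fcard (@other w) predT * 2 = size w.
Proof.
have oI := inv_inj (otherK wfw).
rewrite (fcard_order_set oI) ?card_ord //.
apply/subsetP => k _; rewrite !inE /order.
have [nk _ _ _] := otherP wfw k.
rewrite (@eq_card _ _ (pred2 k (other k))); first by rewrite card2 [k == _]eq_sym nk.
move=> j; rewrite [LHS](@fconnect_cycle _ (@other w) [:: k; other k] _ k) ?mem_head ?inE //.
by rewrite /= otherK // !eqxx.
Qed.

(** Boundaries of sets of faces form a space of dimension F - 1 inside the space of cycles, of
    dimension E - V + 1. The two spaces coincide iff the dimensions do, which is Euler's formula. *)
Lemma planar_ord_bounding (k0 : 'I_(size w)) : planar_code w <-> ord_bounding w.
Proof.
have oI := inv_inj (otherK wfw).
have walk (u : 'I_(size w) -> bool) : (forall k, u (ordS k) = u k) -> forall x y, u x = u y.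
  move=> uS; have n0 : 0 < size w by case: (size w) k0 => [[]|].
  suff u0 : forall i (lti : i < size w), u (Ordinal lti) = u (Ordinal n0).
    by move=> [x ltx] [y lty]; rewrite !u0.
  elim=> [|i IH] lti; first by congr u; apply: val_inj.
  rewrite -(IH (ltnW lti)) -(uS (Ordinal (ltnW lti))); congr u; apply: val_inj => /=.
  by rewrite modn_small.
(* Connectedness of the dual graph: a function on faces that agrees on the two sides of every arc is
   also constant along the curve. *)
have connF (u : 'I_(size w) * bool -> bool) : (forall x, u (face_next x) = u x) ->
    (forall e, u (e, true) = u (e, false)) -> forall x y, u x = u y.
  move=> /(face_nextE wfw) uf ue.
  have uS k : u (ordS k, true) = u (k, true).
    case: (boolP (dir w k)) => dk; first by have [_ e2 e3 _] := uf k dk; rewrite ue e2 -ue e3.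
    have [_ _ dj _] := otherP wfw k; rewrite (negbTE dk) in dj.
    by have [e1 _ e3 _] := uf _ dj; rewrite otherK // in e1 e3; rewrite -e1 ue -e3.
  by move=> [x bx] [y b_y]; case: bx; case: b_y; rewrite -?ue; exact: (walk (fun k => u (k, true))).
have connV (u : 'I_(size w) -> bool) : (forall k, u (other k) = u k) ->
    (forall e, u e = u (ord_pred e)) -> forall x y, u x = u y.
  by move=> _ ue; apply: walk => k; rewrite (ue (ordS k)) ordSK.
(* The row space of [A] consists of the boundaries of sets of faces, and that of [B] of the cuts of
   sets of double points; the ranks are F - 1 and V - 1. *)
have [A [rkA A_P]] := rank_incidence (face_next_inj wfw) connF (k0, true).
have [B [rkB B_P]] := rank_incidence oI connV k0.
have kerB (g : 'rV_(size w)) : (g <= kermx B^T)%MS <-> ord_flow (fun e => g 0%R e).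
  (* Summation by parts around the closed curve. *)
  have dot (v : 'rV_(size w)) (u : 'I_(size w) -> bool) :
      (forall e, v 0%R e = u e (+) u (ord_pred e)) ->
      (g *m v^T)%R 0%R 0%R = (\sum_e (u e && (g 0 e (+) g 0 (ordS e))))%R.
    move=> vE; rewrite mxE.
    transitivity ((\sum_e (g 0 e && u e)) + \sum_e (g 0 e && u (ord_pred e)))%R.
      rewrite -big_split; apply: eq_bigr => e _; rewrite mxE vE; exact: mulrDr.
    rewrite [X in (_ + X)%R](reindex_inj (can_inj (@ordSK _))) /= -big_split.
    by apply: eq_bigr => e _ /=; rewrite ordSK; case: (u e); case: (g _ _); case: (g _ _).
  (* Pairing a kernel vector with the cut of the single double point [k] gives the cycle condition
     there. Conversely, a cycle pairs to zero with every cut, the terms of the two passages of each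
     double point being equal. *)
  split=> [/sub_kermxP gB k|gflow].
    pose u e := (e == k) || (e == other k).
    have [nk _ _ _] := otherP wfw k.
    pose v : 'rV_(size w) := (\row_e (u e (+) u (ord_pred e)))%R.
    have vE e : v 0%R e = u e (+) u (ord_pred e) by rewrite mxE.
    have : (v <= B)%MS.
      apply/B_P; exists u => [e|e]; last exact: vE.
      by rewrite /u (inj_eq oI) -{1}(otherK wfw k) (inj_eq oI) orbC.
    case/submxP=> D DE.
    have := dot _ u vE.
    rewrite DE trmx_mul mulmxA gB mul0mx mxE (bigD1 k) //= (bigD1 (other k)) //=.
    rewrite big1 => [|e /andP[n1 n2]]; last by rewrite /u (negbTE n1) (negbTE n2).
    rewrite /u !eqxx orbT /=.
    rewrite addr0 => /esym; rewrite -[RHS]/false.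
    by case: (g _ _); case: (g _ _); case: (g _ _); case: (g _ _).
  apply/sub_kermxP/rowP => r; rewrite [RHS]mxE.
  have /B_P [u uo uE] : (row r B <= B)%MS by apply: row_sub.
  have := dot _ u uE; rewrite tr_row colE mulmxA -colE mxE => ->.
  apply: (sum_involution (otherK wfw)) => [e|e]; first by have [] := otherP wfw e.
  by rewrite uo gflow otherK.
have rkK : \rank (kermx B^T) = size w - (size w)./2 + 1.
  have := rank_leq_col B; rewrite mxrank_ker mxrank_tr.
  have : (\rank B).+1 * 2 = size w := etrans (congr1 (muln^~ 2) rkB) fcard_other.
  lia.
(* The boundary of a set of faces is a cycle. *)
have AK : (A <= kermx B^T)%MS.
  apply/rV_subP => g /A_P [u uf gE]; apply/kerB => k.
  rewrite !gE; have {}uf := (face_nextE wfw u).1 uf.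
  have main (i : 'I_(size w)) : dir w i ->
      u (i, true) (+) u (i, false) (+) (u (ordS i, true) (+) u (ordS i, false)) =
      u (other i, true) (+) u (other i, false) (+) (u (ordS (other i), true) (+) u (ordS (other i), false)).
    move=> /uf [-> -> -> ->].
    by case: (u _); case: (u _); case: (u _); case: (u _).
  case: (boolP (dir w k)) => dk; first exact: main.
  have [_ _ dj _] := otherP wfw k; rewrite (negbTE dk) in dj.
  by have := main _ dj; rewrite otherK // => ->.
have -> : planar_code w <-> (\rank A = \rank (kermx B^T)).
  rewrite rkK; split=> [[w0|pl]|rk]; last by right; move: fcard_other; rewrite -rkA rk; lia.
    by exfalso; move: (leq_ltn_trans (leq0n k0) (ltn_ord k0)); rewrite (congr1 size w0).
  by apply/succn_inj; rewrite rkA pl; move: fcard_other; lia.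
have -> : (\rank A = \rank (kermx B^T)) <-> (kermx B^T <= A)%MS.
  by rewrite -(mxrank_leqif_sup AK).2; split=> [->|/eqP].
split=> [KA g gf|ob].
  pose v : 'rV_(size w) := (\row_e g e)%R.
  have /submx_trans/(_ KA)/A_P [u uf uE] : (v <= kermx B^T)%MS.
    by apply/kerB => k; rewrite !mxE gf.
  by exists u => // e; rewrite -uE mxE.
by apply/rV_subP => g /kerB/ob [u uf uE]; apply/A_P; exists u.
Qed.


Lemma ord_boundingE (k0 : 'I_(size w)) : ord_bounding w <-> bounding w.
Proof.
have n0 : 0 < size w by exact: leq_ltn_trans (leq0n k0) (ltn_ord k0).
have natS (h : nat -> bool) (k : 'I_(size w)) : h (size w) = h 0 -> h (ordS k) = h k.+1.
  move=> h0 /=; have [ltk|] := ltnP k.+1 (size w); first by rewrite modn_small.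
  by move=> gek; have -> : k.+1 = size w; [have := ltn_ord k; lia | rewrite modnn].
(* Positions are read modulo [size w], so that arc [size w] is arc 0. *)
pose o i : 'I_(size w) := Ordinal (ltn_pmod i n0).
have oE (k : 'I_(size w)) : o k = k by apply: val_inj; rewrite /= modn_small.
have oS (k : 'I_(size w)) : o k.+1 = ordS k by apply: val_inj.
have on : o (size w) = o 0 by apply: val_inj; rewrite /= modnn mod0n.
have other_eq (k j : 'I_(size w)) : k != j -> lab w k = lab w j -> j = other k.
  move=> nkj lkj; have [_ _ _ /(_ j (ltn_ord j) (esym lkj))] := otherP wfw k.
  by rewrite !val_eqE eq_sym (negbTE nkj) => /eqP.
split=> ob g.
  case=> g0 gf; have [|u uf uE] := ob (fun e => g e).
    move=> k; have [nk lk _ _] := otherP wfw k.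
    by rewrite !(natS g) //; apply: gf; rewrite // eq_sym.
  exists (fun i => u (o i, true)); split=> [|k j ltk ltj nkj lkj dk]; first by rewrite on.
  have := other_eq (Ordinal ltk) (Ordinal ltj) nkj lkj.
  rewrite -[k]/(val (Ordinal ltk)) -[j]/(val (Ordinal ltj)) in dk *.
  move: (Ordinal ltk) (Ordinal ltj) dk => {nkj lkj ltk ltj}k {}j dk ->.
  have [e1 e2 e3 e4] := (face_nextE wfw u).1 uf k dk.
  rewrite !oE !oS -(natS g) // !uE e1 -e4 e3; split => //.
    by rewrite -e1; case: (u _); case: (u _).
  by case: (u _); case: (u _).
move=> gf; have [|L [L0 LE]] := ob (fun i => g (o i)).
  split=> [|k j ltk ltj nkj lkj]; first by rewrite on.
  have := other_eq (Ordinal ltk) (Ordinal ltj) nkj lkj.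
  rewrite -[k]/(val (Ordinal ltk)) -[j]/(val (Ordinal ltj)).
  by move: (Ordinal ltk) (Ordinal ltj) => k' j' ->; rewrite !oE !oS gf.
exists (fun x : 'I_(size w) * bool => L x.1 (+) (~~ x.2 && g x.1)) => [|e]; last first.
  by rewrite /=; case: (L _); case: (g _).
apply/(face_nextE wfw) => k dk; have [nk lk _ _] := otherP wfw k.
have [||||e1 e2 e3] := LE k (other k) _ _ _ _ dk => //; first by rewrite eq_sym.
move: e1 e2 e3; rewrite -!(natS L) // !oE !oS /= => -> -> ->.
(* Three corners are the equalities of [face_coloring]; the fourth follows from them and the cycle
   condition at [k]. *)
have := gf k; case: (L _); case: (g _); case: (g _); case: (g _); by case: (g _).
Qed.

Lemma planar_bounding : planar_code w <-> bounding w.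
Proof.
case: (posnP (size w)) => [w0|n0].
  split=> [_ g _|_]; last by left; apply: size0nil.
  by exists (fun _ => false); split=> // k j; rewrite w0.
by rewrite (planar_ord_bounding (Ordinal n0)) (ord_boundingE (Ordinal n0)).
Qed.

End Planar.

(** * Parity, deletion of a loop, kinks *)

(* The faces are coloured as a checkerboard, by the constant flow [true]. *)
Lemma bounding_parity w k j : wf_code w -> bounding w ->
  k < size w -> j < size w -> k != j -> lab w k = lab w j -> odd k != odd j.
Proof.
move=> wfw bw; have [//|L [_ LE]] := bw (fun _ => true).
(* The colour on the left flips at each passage, and the two arcs arriving at a double point have
   opposite colours on their left; so their numbers differ in parity. *)
have both i m : i < size w -> m < size w -> i != m -> lab w i = lab w m ->
    L i.+1 = ~~ L i /\ L m = ~~ L i.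
  move=> lti ltm nim lim; case: (boolP (dir w i)) => di.
    by have [_ -> ->] := LE i m lti ltm nim lim di; rewrite addbT.
  have dm : dir w m.
    have [m' [_ _ [_ dm' _ uni]]] := wf_pos wfw lti.
    have /eqP -> : m == m' by have := uni m ltm (esym lim); rewrite eq_sym (negbTE nim).
    by rewrite dm'.
  rewrite eq_sym in nim; have [-> _ ->] := LE m i ltm lti nim (esym lim) dm.
  by rewrite addbT negbK.
have Lodd i : i <= size w -> L i = L 0 (+) odd i.
  elim: i => [|i IH] lti; first by rewrite addbF.
  have [m [ltm nmi [lm _ _ _]]] := wf_pos wfw lti.
  rewrite eq_sym in nmi; have [-> _] := both i m lti ltm nmi (esym lm).
  by rewrite IH ?(ltnW lti) // addbN.
move=> ltk ltj nkj lkj; have [_] := both k j ltk ltj nkj lkj.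
rewrite (Lodd k (ltnW ltk)) (Lodd j (ltnW ltj)).
by case: (L 0); case: (odd k); case: (odd j).
Qed.

(** * Positions in a code and in a filtered code *)

Section FilterPositions.
Variables (keep : pred passage) (w : seq passage).
Let pos i := count keep (take i w).

Lemma posS i : i < size w -> pos i.+1 = pos i + keep (nth p0 w i).
Proof. by move=> lti; rewrite /pos (take_nth p0 lti) -cats1 count_cat /= addn0. Qed.

Lemma pos_size : pos (size w) = size (filter keep w).
Proof. by rewrite /pos take_size size_filter. Qed.

Lemma leq_pos i j : i <= j -> pos i <= pos j.
Proof.
by move=> leij; rewrite /pos -(subnKC leij) takeD count_cat leq_addr.
Qed.

Lemma ltn_pos i : i < size w -> keep (nth p0 w i) -> pos i < size (filter keep w).
Proof. by move=> lti ki; rewrite -pos_size (leq_trans _ (leq_pos lti)) // posS // ki addn1. Qed.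

Lemma nth_pos i : i < size w -> keep (nth p0 w i) ->
  nth p0 (filter keep w) (pos i) = nth p0 w i.
Proof.
move=> lti ki; rewrite -[in LHS](cat_take_drop i w) filter_cat nth_cat size_filter ltnn.
by rewrite subnn (drop_nth p0 lti) /= ki.
Qed.

Lemma pos_onto m : m < size (filter keep w) ->
  exists i, [/\ i < size w, keep (nth p0 w i) & pos i = m].
Proof.
rewrite -pos_size.
suff: forall n, n <= size w -> m < pos n ->
  exists i, [/\ i < size w, keep (nth p0 w i) & pos i = m] by apply.
elim=> [|n IH] len; first by rewrite /pos take0.
rewrite posS // addnC; case: (boolP (keep _)) => kn; last exact: IH (ltnW len).
rewrite add1n ltnS leq_eqVlt => /predU1P[->|/(IH (ltnW len)) //]; by exists n.
Qed.
End FilterPositions.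

(** * Planarity after deletion of a closed subloop *)

Section Erase.
Variables (B : pred nat) (w : seq passage) (a b : nat).
Hypotheses (wfw : wf_code w) (bw : bounding w).
Hypotheses (ltab : a < b) (ltb : b < size w) (labab : lab w a = lab w b).
Hypothesis (segB : forall i, a <= i <= b -> B (lab w i)).
Hypothesis (Bseg : forall i, i < size w -> B (lab w i) ->
  exists2 j, a <= j <= b & lab w j = lab w i).

Let keep p := ~~ B (label p).
Let pos i := count keep (take i w).
(** The arcs of the loop: arc [i] arrives at position [i], so the first arc of the loop is [a.+1]
    and the last is [b]. *)
Let inside i := a < i <= b.

Let mates k j m : k < size w -> j < size w -> m < size w ->
  k != j -> lab w k = lab w j -> lab w m = lab w k -> (m == k) || (m == j).
Proof.
move=> ltk ltj ltm nkj lkj lmk.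
have [j' [ltj' nj' [lj' _ _ u]]] := wf_pos wfw ltk.
have := u j ltj (esym lkj); rewrite eq_sym (negbTE nkj) /= => /eqP ->.
exact: u.
Qed.

(* A flow on the remaining curve is extended by zero to the erased loop; its
   colouring is then constant across each erased double point. *)
Lemma bounding_erase : bounding (filter keep w).
Proof.
move=> g' [g'0 g'f].
have lta : a < size w by exact: ltn_trans ltb.
have nab : a != b by rewrite neq_ltn ltab.
have posC i : i < size w -> B (lab w i) -> pos i.+1 = pos i.
  by move=> lti Bi; rewrite /pos posS // /keep -/(lab w i) Bi addn0.
have posK i : i < size w -> ~~ B (lab w i) -> pos i.+1 = (pos i).+1.
  by move=> lti Bi; rewrite /pos posS // /keep -/(lab w i) Bi addn1.
(* Nothing is kept from [a] to [b]: the arc entering the loop and the arc leaving it become one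
   arc. *)
have pos_seg : pos b.+1 = pos a.
  have : forall d, a + d <= b -> pos (a + d).+1 = pos a.
    elim=> [|d IH] led; first by rewrite addn0 posC ?segB ?leqnn ?(ltnW ltab).
    by rewrite posC ?(leq_ltn_trans led) ?segB ?leq_addr // addnS IH // ltnW // -addnS.
  by move/(_ (b - a)); rewrite subnKC ?(ltnW ltab) //; apply.
pose g i := if inside i then false else g' (pos i).
have gf : flow w g.
  have in0 : inside 0 = false by [].
  have inn : inside (size w) = false by rewrite /inside [_ <= b]leqNgt ltb andbF.
  split; first by rewrite /g in0 inn /pos pos_size g'0 take0.
  move=> k j ltk ltj nkj lkj; case: (boolP (B (lab w k))) => Bk; last first.
    have out i : i < size w -> lab w i = lab w k -> g i = g' (pos i) /\ g i.+1 = g' (pos i).+1.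
      move=> lti li; have nB : ~~ B (lab w i) by rewrite li.
      have : ~~ (a <= i <= b) by apply: contra nB; exact: segB.
      rewrite -posK // /g /inside => ni.
      by split; case: ifP => //; move: ni; lia.
    have [-> ->] := out k ltk erefl; have [-> ->] := out j ltj (esym lkj).
    have nBj : ~~ B (lab w j) by rewrite -lkj.
    apply: g'f; rewrite ?ltn_pos //; last by rewrite /lab !nth_pos.
    apply: contra nkj => /eqP e; case: ltngtP => // lt.
      by have := leq_pos keep w lt; rewrite -/(pos _) -/(pos _) posK // e ltnn.
    by have := leq_pos keep w lt; rewrite -/(pos _) -/(pos _) posK // e ltnn.
  (* Along the erased passages, [g] can change only at [a] and [b], where the loop closes, and by
     the same amount at both. *)
  have h i : i < size w -> B (lab w i) ->
      g i (+) g i.+1 = ((i == a) || (i == b)) && g' (pos a).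
    move=> lti Bi; rewrite /g /inside.
    case: (eqVneq i a) => [->|na] /=.
      by rewrite ltnn ltnSn ltab addbF.
    case: (eqVneq i b) => [->|nb] /=.
      by rewrite ltab leqnn ltnn andbF pos_seg.
    rewrite posC // (_ : (a < i.+1 <= b) = (a < i <= b)) ?addbb //; lia.
  rewrite !h -?lkj //; congr andb.
  have B1 i m : i < size w -> m < size w -> i != m -> lab w i = lab w m ->
      (i == a) || (i == b) -> (m == a) || (m == b).
    move=> lti ltm nim lim /orP[]/eqP ei; subst i.
      exact: mates lta ltb ltm nab labab (esym lim).
    exact: mates lta ltb ltm nab labab (etrans (esym lim) (esym labab)).
  by apply/idP/idP; apply: B1 => //; rewrite eq_sym.
have [L [L0 LE]] := bw gf.
have gin i : a < i <= b -> g i = false by rewrite /g /inside => ->.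
have step k : k < size w -> B (lab w k) -> ~~ (a <= k <= b) -> L k.+1 = L k.
  move=> ltk Bk out; have [j jin ljk] := Bseg ltk Bk.
  have ltj : j < size w by lia.
  have nkj : k != j by apply: contra out => /eqP ->.
  have [nja njb] : j != a /\ j != b.
    split; apply/eqP => ej; subst j.
      have := mates ltk ltj ltb nkj (esym ljk); rewrite -labab ljk => /(_ erefl); lia.
    have := mates ltk ltj lta nkj (esym ljk); rewrite labab ljk => /(_ erefl); lia.
  case: (boolP (dir w k)) => dk.
    have [_ -> _] := LE k j ltk ltj nkj (esym ljk) dk; rewrite gin ?addbF //; lia.
  have dj : dir w j.
    have [m [_ _ [_ dm _ u]]] := wf_pos wfw ltk.
    by have := u j ltj ljk; rewrite eq_sym (negbTE nkj) => /eqP ->; rewrite dm.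
  rewrite eq_sym in nkj; have [-> _ ->] := LE j k ltj ltk nkj ljk dj.
  rewrite gin ?addbF //; lia.
(* The two arcs that are joined have the same colour on their left: directly at a corner, or by
   going through the loop, where [g] vanishes. *)
have jump : L b.+1 = L a.
  case: (boolP (dir w a)) => da; first by have [] := LE a b lta ltb nab labab da.
  have db : dir w b.
    have [m [_ _ [_ dm _ u]]] := wf_pos wfw lta.
    by have := u b ltb (esym labab); rewrite eq_sym (negbTE nab) => /eqP ->; rewrite dm.
  have nba : b != a by rewrite eq_sym.
  have [_ -> ->] := LE b a ltb lta nba (esym labab) db.
  by rewrite !gin // ?ltab ?leqnn ?ltnSn.
have mono i j : i <= j -> pos i <= pos j by exact: leq_pos.
(* Arcs outside the loop that merge into one arc have the same colour. The induction moves [j] back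
   over one erased passage, or over the whole loop when it reaches [b]. *)
have Lpos j i : i <= j <= size w -> ~~ inside i -> ~~ inside j -> pos i = pos j -> L i = L j.
  elim/ltn_ind: j => j IH /andP[]; rewrite leq_eqVlt => /predU1P[->//|].
  case: j IH => // k IH leik ltk oi oj pij.
  case: (eqVneq k b) => [kb|nkb].
    subst k; rewrite jump; have leia : i <= a by move: oi; rewrite /inside; lia.
    apply: (IH a) => //; first exact: leqW.
    - by rewrite leia ltnW.
    - by rewrite /inside ltnn.
    by rewrite -pos_seg.
  have out : ~~ (a <= k <= b) by move: oj nkb; rewrite /inside; lia.
  have Bk : B (lab w k).
    by apply: contraT => nB; have := mono i k leik; rewrite pij posK // ltnn.
  have ok : ~~ inside k by move: out; rewrite /inside; clear; lia.
  by rewrite (step k) //; apply: (IH k); rewrite // ?pij ?posC // -ltnS leik ltnW.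
(* By [Lpos], the value does not depend on the choice of [i] among the arcs merged into [m]. *)
pose L' m := `[< exists i, [/\ i <= size w, ~~ inside i, pos i = m & L i] >].
have L'E : forall j, j <= size w -> ~~ inside j -> L' (pos j) = L j.
  move=> q leq oq; apply/asboolP/idP => [[r [ler or pr Lr]]|Lq]; last by exists q.
  by case/orP: (leq_total q r) => le; [rewrite (@Lpos r q) ?le | rewrite -(@Lpos q r) ?le].
exists L'; split.
  have -> : size (filter keep w) = pos (size w) by rewrite /pos pos_size.
  have -> : 0 = pos 0 by rewrite /pos take0.
  by rewrite !L'E // /inside [_ <= b]leqNgt ltb andbF.
move=> k' j' /pos_onto[k [ltk Kk <-]] /pos_onto[j [ltj Kj <-]] nkj.
rewrite /lab /dir !nth_pos // -/(lab w k) -/(lab w j) -/(dir w k) => lkj dk.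
have {}nkj : k != j by apply: contra nkj => /eqP ->.
have out i : i < size w -> ~~ B (lab w i) ->
    [/\ ~~ inside i, ~~ inside i.+1, L' (pos i) = L i, L' (pos i).+1 = L i.+1 &
     g i = g' (pos i) /\ g i.+1 = g' (pos i).+1].
  move=> lti nB; have ni : ~~ (a <= i <= b) by apply: contra nB; exact: segB.
  have [o1 o2] : ~~ inside i /\ ~~ inside i.+1 by move: ni; rewrite /inside; clear; lia.
  by rewrite -posK // !L'E // ?(ltnW lti) // /g (negbTE o1) (negbTE o2).
have [_ _ -> -> [gk gk1]] := out k ltk Kk; have [_ _ -> -> [gj gj1]] := out j ltj Kj.
by rewrite -gk -gj1; exact: LE.
Qed.
End Erase.

(** The loop runs from [p] to [p']; as these share their label, erasing the labels of [p :: s]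
    erases both ends. *)
Lemma bounding_erase_loop x p s p' y :
  let w := x ++ p :: s ++ p' :: y in
  wf_code w -> bounding w -> label p = label p' ->
  bounding [seq q <- w | label q \notin map label (p :: s)].
Proof.
move=> w wfw bw lpp; pose a := size x; pose b := a + (size s).+1.
have sw : size w = a + (size s + size y).+2 by rewrite /w !size_cat /= size_cat /=; lia.
have nthm m : m < size w -> a <= m ->
    lab w m = nth 0 (map label (p :: s ++ p' :: y)) (m - a).
  move=> ltm gem; rewrite /lab /w nth_cat ltnNge gem (nth_map p0) //.
  by move: ltm; rewrite sw /= size_cat /=; clear -gem; lia.
have la : lab w a = label p by rewrite /lab nth_cat ltnn subnn.
have lb : lab w b = label p.
  rewrite /lab nth_cat ltnNge leq_addr /= /b addKn /= nth_cat ltnn subnn //=.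
have ltab : a < b by rewrite /b addnS ltnS leq_addr.
have ltb : b < size w by rewrite sw /b; clear; lia.
have seg i : a <= i < b -> lab w i = nth 0 (map label (p :: s)) (i - a).
  move=> /andP[ai ib]; rewrite nthm ?(ltn_trans ib) //.
  have e : i - a < size (map label (p :: s)).
    by rewrite size_map; move: ib; rewrite /b /=; clear -ai; lia.
  by rewrite -[p :: s ++ p' :: y]/((p :: s) ++ p' :: y) map_cat nth_cat e.
have := @bounding_erase (fun c => c \in map label (p :: s)) w a b wfw bw ltab ltb.
apply; first by rewrite la lb.
  move=> i /andP[ai ib]; move: ib; rewrite leq_eqVlt => /predU1P[->|ib].
    by rewrite lb mem_head.
  rewrite seg ?ai //; apply: mem_nth; rewrite size_map /=.
  by move: ib; rewrite /b; clear -ai; lia.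
move=> i lti /nthP - /(_ 0)[j]; rewrite size_map => ltj ej.
exists (a + j); first by rewrite leq_addr /b; move: ltj => /=; clear; lia.
rewrite seg ?addKn //; first by rewrite leq_addr /b; move: ltj => /=; clear; lia.
Qed.

(** A cycle takes the same value before and after the kink, hence induces a cycle on the code
    without it; the colouring found there extends to the kink. *)
Lemma bounding_kink x y p q :
  wf_code (x ++ p :: q :: y) -> label p = label q ->
  bounding (x ++ y) -> bounding (x ++ p :: q :: y).
Proof.
set w2 := x ++ p :: q :: y; set w := x ++ y => wf2 lpq bw g [g0 gf].
(* [sg] sends a position of [w] to its place in [w2], skipping the two passages of the kink. *)
pose a := size x; pose sg m := if m < a then m else m.+2.
have sw2 : size w2 = (size w).+2 by rewrite !size_cat /= !addnS.
have lea : a <= size w by rewrite size_cat leq_addr.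
have nthsg m : nth p0 w2 (sg m) = nth p0 w m.
  rewrite /sg !nth_cat -/a; case: (ltnP m a) => [->//|le].
  have -> : (m.+2 < a) = false by move: le; clear; lia.
  by have -> : m.+2 - a = (m - a).+2 by move: le; clear; lia.
have ltsg m : m < size w -> sg m < size w2 by rewrite sw2 /sg; clear; case: ifP; lia.
have sg_inj m1 m2 : sg m1 = sg m2 -> m1 = m2 by rewrite /sg; clear; do 2!case: ifP; lia.
have na : nth p0 w2 a = p by rewrite nth_cat ltnn subnn.
have na1 : nth p0 w2 a.+1 = q by rewrite nth_cat ltnNge leqnSn /= subSnn.
have lta1 : a.+1 < size w2 by rewrite sw2 !ltnS.
have lta : a < size w2 := ltnW lta1.
have naa : a != a.+1 by rewrite neq_ltn ltnSn.
have lpq' : lab w2 a = lab w2 a.+1 by rewrite /lab na na1.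
have ga : g a.+2 = g a.
  have := gf a a.+1 lta lta1 naa lpq'.
  by case: (g a); case: (g a.+1); case: (g a.+2).
pose g' m := if m <= a then g m else g m.+2.
have g'E m : g' m = g (sg m).
  by rewrite /g' /sg; case: (ltngtP m a) => [||->]; rewrite ?ga.
have g'S m : g' m.+1 = g (sg m).+1 by rewrite /g' /sg; case: ifP.
have gE : flow w g'.
  split.
    rewrite {2}/g' leq0n -g0 sw2 /g'; case: ifP => // le.
    by have -> : size w = a by [apply/eqP; rewrite eqn_leq le]; rewrite ga.
  move=> k j ltk ltj nkj lkj; rewrite !g'S !g'E; apply: gf; rewrite ?ltsg //.
    by apply: contra nkj => /eqP/sg_inj ->.
  by rewrite /lab !nthsg.
have [L [L0 LE]] := bw _ gE.
(* Arcs [a] and [a.+2] both come from the old arc [a]. The colour to the left of the new arc [a.+1]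
   is forced by a corner equality, which depends on the direction of the kink. *)
pose L2 i := if i <= a then L i else
  if i == a.+1 then L a (+) (if dir w2 a then g a else g a.+1) else L i.-2.
exists L2.
have L2E m : L2 (sg m) = L m.
  rewrite /L2 /sg; case: (ltnP m a) => [lt|ge]; first by rewrite ltnW.
  have -> : (m.+2 <= a) = false by move: ge; clear; lia.
  by have -> : (m.+2 == a.+1) = false by move: ge; clear; lia.
have L2S m : L2 (sg m).+1 = L m.+1.
  rewrite /L2 /sg; case: (ltnP m a) => [-> //|ge].
  have -> : (m.+3 <= a) = false by move: ge; clear; lia.
  by have -> : (m.+3 == a.+1) = false by move: ge; clear; lia.
have uniq2 k : k < size w2 -> lab w2 k = lab w2 a -> (k == a) || (k == a.+1).
  move=> ltk lk; have [j [_ _ [_ _ _ u]]] := wf_pos wf2 lta.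
  have := u _ lta1 (esym lpq'); rewrite gtn_eqF //= => /eqP ->.
  exact: u.
have dirS : dir w2 a.+1 = ~~ dir w2 a.
  have [j [_ _ [_ dj _ u]]] := wf_pos wf2 lta.
  by have := u _ lta1 (esym lpq'); rewrite gtn_eqF //= => /eqP ->.
have onto k : k < size w2 -> (k == a) || (k == a.+1) \/ exists2 m, k = sg m & m < size w.
  move=> ltk; case: (boolP (_ || _)) => // nk; [by left | right].
  have [lt|ge] := ltnP k a; [exists k | exists k.-2]; rewrite /sg ?lt //.
  - exact: leq_trans lt lea.
  - by have -> : (k.-2 < a) = false; move: nk ge; clear; lia.
  by move: ltk nk ge; rewrite sw2; clear; lia.
split.
  rewrite sw2 {2}/L2 leq0n -L0 /L2.
  have -> : ((size w).+2 <= a) = false by move: lea; clear; lia.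
  by have -> : ((size w).+2 == a.+1) = false by move: lea; clear; lia.
move=> k j ltk ltj nkj lkj dk.
have [/orP[]/eqP ek|[m ek ltm]] := onto k ltk.
- subst k; have := uniq2 j ltj (esym lkj); rewrite eq_sym (negbTE nkj) /= => /eqP ej; subst j.
  have -> : L2 a = L a by rewrite /L2 leqnn.
  have -> : L2 a.+2 = L a by rewrite /L2 leqNgt ltnS leqnSn /= gtn_eqF.
  by rewrite /L2 ltnn eqxx dk ga.
- subst k; have := uniq2 j ltj; rewrite -lkj lpq' => /(_ erefl).
  rewrite [j == a.+1]eq_sym (negbTE nkj) orbF => /eqP ej; subst j.
  have nd : dir w2 a = false by move: dk; rewrite dirS => /negbTE.
  have -> : L2 a = L a by rewrite /L2 leqnn.
  have -> : L2 a.+2 = L a by rewrite /L2 leqNgt ltnS leqnSn /= gtn_eqF.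
  by rewrite /L2 ltnn eqxx nd -addbA addbb addbF.
have [ej|[m' ej ltm']] := onto j ltj.
  exfalso; have := uniq2 k ltk.
  have -> : lab w2 k = lab w2 a by rewrite lkj; case/orP: ej => /eqP ->.
  by move=> /(_ erefl); rewrite ek /sg; clear; case: ifP; lia.
subst k j; rewrite !L2E !L2S.
have lmm : lab w m = lab w m' by move: lkj; rewrite /lab !nthsg.
have dm : dir w m by move: dk; rewrite /dir nthsg.
have nmm : m != m' by apply: contra nkj => /eqP ->.
by have := LE m m' ltm ltm' nmm lmm dm; rewrite g'S g'E.
Qed.

(** * The Arf invariant *)

Lemma wf_count w c : wf_code w ->
  count (fun p => label p == c) w = 0 \/ count (fun p => label p == c) w = 2.
Proof. by move=> /(_ c); rewrite -size_filter => -[->|[k [d ->]]]; [left|right]. Qed.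

Lemma count_label0 c s : count (fun p => label p == c) s = 0 -> c \notin map label s.
Proof.
by elim: s => //= p s IH; rewrite inE negb_or [c == _]eq_sym; case: eqVneq.
Qed.

Lemma wf_cat x y : wf_code (x ++ y) -> wf_code (y ++ x).
Proof.
move=> h c; have := h c; rewrite !filter_cat.
move: (filter _ x) (filter _ y) => [|p [|q [|r X]]] [|p' [|q' [|r' Y]]] //= [] // [k [d []]] *; subst;
  by [left|right; exists k, d|right; exists (mate k), (~~ d); rewrite mateK negbK].
Qed.

Definition is_over k := if k is Over then true else false.

(* The passages through [a] and [b], in order; [true] marks those through [a]. *)
Definition pair_word a b w : seq (bool * bool) :=
  [seq (label p == a, is_over (kind p)) | p <- w & (label p == a) || (label p == b)].

(* The signs of the Polyak-Viro formula are irrelevant mod 2. *)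
Definition arf_pair w a b : bool :=
  (a != b) && (pair_word a b w == [:: (true, true); (false, false); (true, false); (false, true)]).

(** The list [L] of labels is a parameter so that two codes can be compared over a common list. *)
Definition arf_on L w := \big[addb/false]_(a <- L) \big[addb/false]_(b <- L) arf_pair w a b.

Definition arf w := arf_on (undup (map label w)) w.

Lemma pair_word_cat a b x y : pair_word a b (x ++ y) = pair_word a b x ++ pair_word a b y.
Proof. by rewrite /pair_word filter_cat map_cat. Qed.

Definition over_word b w := [seq is_over (kind p) | p <- w & label p == b].

Lemma pair_word_absent a b s : a \notin map label s ->
  pair_word a b s = map (pair false) (over_word b s).
Proof.
elim: s => //= p s IH; rewrite inE negb_or eq_sym /pair_word /over_word /=.
move=> /andP[/negbTE na /IH e].
by rewrite na /=; case: ifP => //= _; rewrite ?na -/(pair_word a b s) e.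
Qed.

Lemma pair_word_sym a b w : a != b ->
  pair_word b a w = [seq (~~ x.1, x.2) | x <- pair_word a b w].
Proof.
move=> nab; elim: w => // p w IH; rewrite /pair_word /= orbC.
case: ifP => [|_]; last exact: IH.
rewrite /= -/(pair_word a b w) -/(pair_word b a w) -IH => /orP[]/eqP ->; rewrite eqxx.
  by rewrite (negbTE nab).
by rewrite eq_sym (negbTE nab).
Qed.

Lemma arf_pair_mem w a b : arf_pair w a b -> (a \in map label w) && (b \in map label w).
Proof.
case/andP=> nab /eqP e; rewrite -[_ && _]negbK negb_and; apply/negP => /orP[]na.
  move: e; rewrite (pair_word_absent _ na).
  by case: (over_word _ _).
have := pair_word_sym w nab; rewrite e (pair_word_absent _ na) /=.
by case: (over_word _ _) => [|? []].
Qed.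

Lemma sum_support (L L0 : seq nat) (F : nat -> bool) : uniq L -> uniq L0 ->
  {subset L0 <= L} -> (forall u, u \in L -> u \notin L0 -> F u = false) ->
  \big[addb/false]_(u <- L) F u = \big[addb/false]_(u <- L0) F u.
Proof.
move=> uL u0 sub F0; rewrite (bigID (mem L0)) /= [X in _ (+) X]big1_seq ?addbF; last first.
  by move=> u /andP[nu uinL]; apply: F0.
rewrite -big_filter; apply: perm_big; apply: uniq_perm; rewrite ?filter_uniq // => u.
rewrite mem_filter; case: (boolP (u \in L0)) => [/sub -> //|//].
Qed.

Lemma sum2_support (L L0 : seq nat) (F : nat -> nat -> bool) : uniq L -> uniq L0 ->
  {subset L0 <= L} -> (forall u v, ~~ ((u \in L0) && (v \in L0)) -> F u v = false) ->
  \big[addb/false]_(u <- L) \big[addb/false]_(v <- L) F u v =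
  \big[addb/false]_(u <- L0) \big[addb/false]_(v <- L0) F u v.
Proof.
move=> uL u0 sub F0; rewrite (@sum_support L L0) //; last first.
  by move=> u _ nu; rewrite big1 // => v _; apply: F0; rewrite (negbTE nu).
apply: eq_bigr => u _; apply: sum_support => // v _ nv.
by apply: F0; rewrite (negbTE nv) andbF.
Qed.

Lemma arfE L w : uniq L -> {subset map label w <= L} -> arf w = arf_on L w.
Proof.
move=> uL sub; rewrite /arf /arf_on; symmetry; apply: sum2_support => //.
- exact: undup_uniq.
- by move=> u; rewrite mem_undup; apply: sub.
move=> u v; rewrite !mem_undup; apply: contraNF; exact: arf_pair_mem.
Qed.

(** * Invariance of the Arf invariant under relabelling, reversal and Reidemeister moves *)

Lemma arf_relabel f w : injective f -> arf (map (relabel f) w) = arf w.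
Proof.
move=> injf; rewrite /arf /arf_on -map_comp.
rewrite (_ : map (label \o relabel f) w = map f (map label w)); last by rewrite -map_comp.
rewrite undup_map_inj // !big_map; apply: eq_bigr => a _; rewrite big_map; apply: eq_bigr => b _.
rewrite /arf_pair (inj_eq injf); congr (_ && (_ == _)).
rewrite /pair_word filter_map -map_comp.
rewrite (eq_filter (a2 := fun p => (label p == a) || (label p == b))); last first.
  by move=> p /=; rewrite !(inj_eq injf).
by apply: eq_map => p /=; rewrite (inj_eq injf).
Qed.

(** The pattern counted by [arf_pair], read backwards, is the same pattern with the two chords
    exchanged. *)
Lemma arf_rev w : arf (rev w) = arf w.
Proof.
have uL := undup_uniq (map label w).
rewrite (@arfE (undup (map label w)) (rev w)) //; last first.
  by move=> u; rewrite map_rev mem_rev mem_undup.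
rewrite /arf /arf_on exchange_big /=; apply: eq_bigr => a _; apply: eq_bigr => b _.
rewrite /arf_pair eq_sym; case: eqVneq => //= nab.
have -> : pair_word b a (rev w) = rev (pair_word b a w).
  by rewrite /pair_word filter_rev map_rev.
rewrite (pair_word_sym _ nab) -(inj_eq (can_inj revK)) revK.
rewrite -(inj_eq (f := map (fun x : bool * bool => (~~ x.1, x.2)))) /=; last first.
  by apply: inj_map => -[[] []] [[] []].
by rewrite -map_comp map_id_in // => -[[] ?] _.
Qed.

Lemma arf_diff L w1 w2 : uniq L -> {subset map label w1 <= L} -> {subset map label w2 <= L} ->
  \big[addb/false]_(u <- L) \big[addb/false]_(v <- L) (arf_pair w1 u v (+) arf_pair w2 u v) = false ->
  arf w1 = arf w2.
Proof.
move=> uL s1 s2; rewrite (arfE uL s1) (arfE uL s2) /arf_on.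
under eq_bigr do rewrite big_split /=.
rewrite big_split /=; by case: (bigop _ _ _); case: (bigop _ _ _).
Qed.

Lemma arf_pairC w u v : u != v ->
  arf_pair w u v = (pair_word v u w == [:: (false, true); (true, false); (false, false); (true, true)]).
Proof.
move=> nuv; rewrite /arf_pair nuv (pair_word_sym _ nuv) /=.
rewrite -(inj_eq (f := map (fun x : bool * bool => (~~ x.1, x.2)))) //.
by apply: inj_map => -[[] []] [[] []].
Qed.

Lemma arf_eq w1 w2 : (forall u v, u != v -> arf_pair w1 u v = arf_pair w2 u v) -> arf w1 = arf w2.
Proof.
move=> e; apply: (@arf_diff (undup (map label (w1 ++ w2)))); rewrite ?undup_uniq //.
- by move=> u; rewrite mem_undup map_cat mem_cat => ->.
- by move=> u; rewrite mem_undup map_cat mem_cat orbC => ->.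
rewrite big1 // => u _; rewrite big1 // => v _.
case: (eqVneq u v) => [->|/e ->]; last exact: addbb.
by rewrite /arf_pair eqxx.
Qed.

Lemma pair_word_nil a b s : a \notin map label s -> b \notin map label s -> pair_word a b s = [::].
Proof.
move=> na nb; rewrite (pair_word_absent _ na); elim: s nb {na} => //= p s IH.
by rewrite inE negb_or eq_sym /over_word /= => /andP[/negbTE -> /IH].
Qed.

(** The chord of a kink has adjacent ends, hence is interlaced with no other chord. *)
Lemma arf_R1 x y p q : wf_code (x ++ [:: p; q] ++ y) -> label p = label q ->
  arf (x ++ y) = arf (x ++ [:: p; q] ++ y).
Proof.
move=> wfw lpq; set a := label p.
have [nx ny] : a \notin map label x /\ a \notin map label y.
  have := wf_count a wfw; rewrite !count_cat /= -lpq eqxx.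
  by move=> h; split; apply: count_label0; case: h; clear; lia.
have pqE v : pair_word a v [:: p; q] = [:: (true, is_over (kind p)); (true, is_over (kind q))].
  by rewrite /pair_word /= -lpq /a eqxx /= -lpq eqxx.
have case_a u v : u != v -> u = a \/ v = a -> arf_pair (x ++ y) u v = false /\
    arf_pair (x ++ [:: p; q] ++ y) u v = false.
  move=> nuv [] e; rewrite {}e in nuv *; [rewrite /arf_pair nuv !andTb | rewrite !arf_pairC //].
    rewrite !pair_word_cat !pqE !(pair_word_absent _ nx) !(pair_word_absent _ ny).
    by case: (over_word v x) => //; case: (over_word v y); case: (is_over (kind p)).
  rewrite !pair_word_cat !pqE !(pair_word_absent _ nx) !(pair_word_absent _ ny).
  case: (over_word u x) => [|[] [|? ?]] //=; case: (over_word u y) => [|[] [|? ?]] //=;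
    by case: (is_over (kind p)).
apply: arf_eq => u v nuv.
case: (eqVneq u a) => [|nua]; first by move=> ua; have [-> ->] := case_a u v nuv (or_introl ua).
case: (eqVneq v a) => [|nva]; first by move=> va; have [-> ->] := case_a u v nuv (or_intror va).
rewrite /arf_pair !pair_word_cat (@pair_word_nil u v [:: p; q]) //.
  by rewrite /= -lpq !inE orbb.
by rewrite /= -lpq !inE orbb.
Qed.

Lemma is_over_level l : is_over (level l) = l.
Proof. by case: l. Qed.

Lemma arf_pair_neq w u v : u = v -> arf_pair w u v = false.
Proof. by move=> ->; rewrite /arf_pair eqxx. Qed.

Lemma arf_pair_absent w u v : (u \notin map label w) || (v \notin map label w) -> arf_pair w u v = false.
Proof. by rewrite -negb_and; apply: contraNF; exact: arf_pair_mem. Qed.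

(** The two new chords form the same word with any third chord, so their contributions cancel mod 2.
    The pair they form does not count, its first two passages being both over or both under. *)
Lemma arf_R2 x y z a a' l d e :
  let w2 := x ++ [:: Passage a (level l) d; Passage a' (level l) (~~ d)]
                  ++ y ++ orient e [:: Passage a (level (~~ l)) (~~ d);
                                       Passage a' (level (~~ l)) d] ++ z in
  wf_code w2 -> arf (x ++ y ++ z) = arf w2.
Proof.
move=> w2 wf2; set w1 := x ++ y ++ z.
(* As a label occurs 0 or 2 times in [w2], this count shows that [a] and [a'] are distinct and
   absent from [w1]. *)
have cnt c : count (fun p => label p == c) w2 =
    count (fun p => label p == c) w1 + ((a == c) + (a' == c)) * 2.
  rewrite /w2 /w1 !count_cat /=; case: (e) => /=; lia.
have naa : a' != a.
  by apply/eqP => ea; have := wf_count a wf2; rewrite cnt ea eqxx; lia.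
have [na na'] : a \notin map label w1 /\ a' \notin map label w1.
  split; apply: count_label0.
    by have := wf_count a wf2; rewrite cnt eqxx; lia.
  by have := wf_count a' wf2; rewrite cnt eqxx; lia.
move: (na) (na'); rewrite !map_cat !mem_cat !negb_or.
case/and3P=> nx ny nz; case/and3P=> nx' ny' nz'.
set L1 := undup (map label w1).
have memL1 u : u \in L1 -> (u == a = false) * (u == a' = false).
  by rewrite mem_undup => uw; split; apply/negbTE; apply: contraTneq uw => ->.
apply: (@arf_diff [:: a, a' & L1]).
- by rewrite /= inE negb_or eq_sym naa !mem_undup na na' undup_uniq.
- by move=> u; rewrite !inE mem_undup orbA orbC => ->.
- move=> u; rewrite !inE mem_undup /w1 /w2 !map_cat !mem_cat /=; case: (e); rewrite /= !inE;
    by case: (u == a); case: (u == a'); case: (u \in map label x);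
       case: (u \in map label y); case: (u \in map label z).
have pa v : v \in L1 -> pair_word a v w2 = pair_word a' v w2.
  move=> /memL1[]; rewrite eq_sym => va; rewrite eq_sym => va'.
  rewrite /w2 !pair_word_cat !(pair_word_absent _ nx) !(pair_word_absent _ ny) !(pair_word_absent _ nz).
  rewrite !(pair_word_absent _ nx') !(pair_word_absent _ ny') !(pair_word_absent _ nz').
  congr (_ ++ (_ ++ (_ ++ (_ ++ _)))); [|case: (e)];
    by rewrite /pair_word /= ?va ?va' ?eqxx ?[a == a']eq_sym ?(negbTE naa) /= ?va ?va' ?eqxx.
have Fa v : v \in L1 -> (arf_pair w2 a v = arf_pair w2 a' v) * (arf_pair w2 v a = arf_pair w2 v a').
  move=> vL; have [va va'] := memL1 _ vL.
  split; last by rewrite !arf_pairC ?va ?va' // pa.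
  by rewrite /arf_pair ![_ == v]eq_sym va va' pa.
have F0 : arf_pair w2 a a' = false /\ arf_pair w2 a' a = false.
  rewrite arf_pairC 1?eq_sym // /arf_pair naa /= /w2 !pair_word_cat.
  rewrite !(pair_word_nil nx') // !(pair_word_nil ny') //.
  rewrite /pair_word /= ?eqxx ?[a == a']eq_sym ?(negbTE naa) /= ?eqxx ?[a == a']eq_sym ?(negbTE naa) /=.
  by rewrite is_over_level; case: (l).
have F1 v : (arf_pair w1 a v = false) * (arf_pair w1 a' v = false) *
    ((arf_pair w1 v a = false) * (arf_pair w1 v a' = false)).
  by split; split; apply: arf_pair_absent; rewrite ?na ?na' ?orbT.
rewrite !big_cons !F1 F0.1 F0.2 !(arf_pair_neq w2 erefl) !addFb.
rewrite (eq_big_seq (fun v => arf_pair w2 a' v)); last first.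
  by move=> v vL; rewrite F1 (Fa _ vL).1.
set S := \big[_/_]_(v <- L1) _.
rewrite (_ : \big[_/_]_(v <- L1) (arf_pair w1 a' v (+) _) = S); last first.
  by apply: eq_bigr => v _; rewrite F1.
rewrite addbA addbb addFb big1_seq // => u /= uL; rewrite !big_cons !F1 !addFb.
rewrite (Fa u uL).2 addbA addbb addFb big1_seq // => v /= vL.
have [ua ua'] := memL1 _ uL; have [va va'] := memL1 _ vL.
rewrite /arf_pair; case: eqVneq => //= _.
have -> : pair_word u v w2 = pair_word u v w1; last exact: addbb.
rewrite /w2 /w1 !pair_word_cat; congr (_ ++ _).
have nl b p q : label p = a -> label q = a' -> pair_word u v (orient b [:: p; q]) = [::].
  by move=> lp lq; apply: pair_word_nil; case: b; rewrite /= !inE lp lq ?ua ?ua' ?va ?va'.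
by rewrite (nl e) // (nl true).
Qed.

Lemma pair_word_swap u v p q : ~~ ((label p \in [:: u; v]) && (label q \in [:: u; v])) ->
  pair_word u v [:: p; q] = pair_word u v [:: q; p].
Proof.
by rewrite /pair_word /= !inE; case: (_ || _); case: (_ || _).
Qed.

Lemma pair_word_orient u v e p q : ~~ ((label p \in [:: u; v]) && (label q \in [:: u; v])) ->
  pair_word u v (orient e [:: p; q]) = pair_word u v (orient (~~ e) [:: p; q]).
Proof. by case: e => /pair_word_swap. Qed.

(** Exchanging two adjacent passages affects only the pair of their chords, so only pairs among [a],
    [b], [c] can change. Their total contribution is preserved when the three strands are stacked
    without a cycle. *)
Lemma arf_R3 x0 x1 x2 x3 a b c da db dc da' db' dc' e1 e2 e3 la lb lc :
  (la == lc) ==> (lb == la) ->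
  let s1 := [:: Passage a (level la) da; Passage b (level lb) db] in
  let s2 := [:: Passage a (level (~~ la)) da'; Passage c (level lc) dc] in
  let s3 := [:: Passage b (level (~~ lb)) db'; Passage c (level (~~ lc)) dc'] in
  let w1 := x0 ++ orient e1 s1 ++ x1 ++ orient e2 s2 ++ x2 ++ orient e3 s3 ++ x3 in
  let w2 := x0 ++ orient (~~ e1) s1 ++ x1 ++ orient (~~ e2) s2 ++ x2 ++ orient (~~ e3) s3 ++ x3 in
  wf_code w1 -> arf w1 = arf w2.
Proof.
move=> acyc s1 s2 s3 w1 w2 wf1.
set x := x0 ++ x1 ++ x2 ++ x3.
have cnt k : count (fun p => label p == k) w1 =
    count (fun p => label p == k) x + ((a == k) + (b == k) + (c == k)) * 2.
  rewrite /w1 /x !count_cat /=; case: (e1); case: (e2); case: (e3) => /=; lia.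
have nab : (a == b) = false.
  by apply/eqP => e; have := wf_count a wf1; rewrite cnt -e eqxx; lia.
have nac : (a == c) = false.
  by apply/eqP => e; have := wf_count a wf1; rewrite cnt -e eqxx; lia.
have nbc : (b == c) = false.
  by apply/eqP => e; have := wf_count b wf1; rewrite cnt -e eqxx; lia.
have notx k : k \in [:: a; b; c] -> [/\ k \notin map label x0, k \notin map label x1,
    k \notin map label x2 & k \notin map label x3].
  move=> kabc; have : k \notin map label x.
    apply: count_label0; have := wf_count k wf1; rewrite cnt.
    by move: kabc; rewrite !inE => /or3P[]/eqP ->; rewrite eqxx; lia.
  by rewrite /x !map_cat !mem_cat !negb_or => /and4P[].
set L := undup (map label (w1 ++ w2)).
have memL k : k \in [:: a; b; c] -> k \in L.
  rewrite mem_undup /w1 !map_cat !mem_cat.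
  by rewrite !inE => /or3P[]/eqP ->; case: (e1); case: (e2); rewrite /= !inE eqxx !orbT.
apply: (@arf_diff L); rewrite ?undup_uniq //.
- by move=> u; rewrite mem_undup map_cat mem_cat => ->.
- by move=> u; rewrite mem_undup map_cat mem_cat orbC => ->.
rewrite (@sum2_support _ [:: a; b; c]) ?undup_uniq //; first last.
- move=> u v nuv; rewrite /arf_pair; case: eqVneq => //= neq.
  suff -> : pair_word u v w1 = pair_word u v w2 by rewrite addbb.
  rewrite /w1 /w2 !pair_word_cat.
  have sw e p q : label p != label q -> label p \in [:: a; b; c] -> label q \in [:: a; b; c] ->
      pair_word u v (orient e [:: p; q]) = pair_word u v (orient (~~ e) [:: p; q]).
    move=> npq pin qin; apply: pair_word_orient; apply: contra nuv.
    rewrite [label p \in [:: u; v]]inE [label q \in [:: u; v]]inE !mem_seq1.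
    case/andP=> /orP[]/eqP ep /orP[]/eqP eq; rewrite ?ep ?eq ?eqxx // in npq pin qin *.
    - by rewrite pin qin.
    - by rewrite pin qin.
  by rewrite (sw e1) ?(sw e2) ?(sw e3) //= ?nab ?nac ?nbc // !inE eqxx ?orbT.
- by rewrite /= !inE nab nac nbc.
rewrite !big_cons !big_nil !(arf_pair_neq _ erefl).
have pw u v y1 y2 y3 : u \in [:: a; b; c] -> v \in [:: a; b; c] ->
    pair_word u v (x0 ++ y1 ++ x1 ++ y2 ++ x2 ++ y3 ++ x3) = pair_word u v (y1 ++ y2 ++ y3).
  move=> /notx[u0 u1 u2 u3] /notx[v0 v1 v2 v3].
  by rewrite !pair_word_cat (pair_word_nil u0) // (pair_word_nil u1) //
    (pair_word_nil u2) // (pair_word_nil u3) // cats0.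
have [aL bL cL] : [/\ a \in [:: a; b; c], b \in [:: a; b; c] & c \in [:: a; b; c]].
  by rewrite !inE !eqxx !orbT.
rewrite /arf_pair !pw // {pw notx cnt x memL L}.
have [nba [nca ncb]] : b == a = false /\ c == a = false /\ c == b = false.
  by rewrite ![_ == a]eq_sym [c == b]eq_sym.
have nE := (nab, nac, nbc, nba, nca, ncb, eqxx).
pose f u v r := if (label r == u) || (label r == v) then [:: (label r == u, is_over (kind r))] else [::].
have pw2 u v e p q : pair_word u v (orient e [:: p; q]) =
    if e then f u v p ++ f u v q else f u v q ++ f u v p.
  rewrite /pair_word /f; case: e => /=;
    by do 2?[case: ((_ || _))].
rewrite !pair_word_cat !pw2 /f /= !nE /= !is_over_level.
(* What remains is a finite check over the orders of the passages and the levels of the strands. *)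
move: acyc; clear; case: e1; case: e2; case: e3; case: la; case: lb; by case: lc.
Qed.

(** * Gauss's parity condition and change of base point *)

Definition gauss_even w := forall x p s p' y,
  w = x ++ p :: s ++ p' :: y -> label p = label p' -> ~~ odd (size s).

Lemma planar_gauss_even w : wf_code w -> planar_code w -> gauss_even w.
Proof.
move=> wfw /(planar_bounding wfw) bw x p s p' y ew lpp.
have sw : size w = size x + (size s + size y).+2 by rewrite ew !size_cat /= size_cat /=; lia.
have := @bounding_parity w (size x) (size x + (size s).+1) wfw bw.
rewrite addnS oddS oddD; case: (odd (size x)); case: (odd (size s)) => //= h.
all: exfalso; suff: false by []; apply: h; rewrite ?sw; try lia.
all: rewrite ew /lab nth_cat ltnn subnn /= lpp nth_cat ltnNge -addnS leq_addr /= addKn /=.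
all: by rewrite nth_cat ltnn subnn.
Qed.

(** For the chord of [p], the gap between its ends is replaced by the complementary gap, of the same
    parity because the total length is even. *)
Lemma gauss_even_rot1 p w : ~~ odd (size w).+1 -> gauss_even (p :: w) -> gauss_even (rcons w p).
Proof.
move=> ev h x q s q' y; case/lastP: y => [|y r].
  rewrite -cats1 -cat_cons catA !cats1 => /rcons_inj[ew ep] lq.
  have : ~~ odd (size x) by apply: (h [::] p x q s); rewrite /= ?ew ?ep.
  by move: ev; rewrite ew size_cat /= addnS /= oddD; case: (odd (size x)); case: (odd (size s)).
rewrite -rcons_cons -rcons_cat -rcons_cons -rcons_cat => /rcons_inj[ew _].
by apply: (h (p :: x) q s q' y); rewrite /= ew.
Qed.

Lemma wf_even w : wf_code w -> ~~ odd (size w).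
Proof. by move=> wfw; rewrite -(fcard_other wfw) muln2 odd_double. Qed.

(** Serves to count mod 2 the chords interlaced with a given chord: they are those met an odd number
    of times between its ends. *)
Lemma sum_odd_count (L : seq nat) s : uniq L -> {subset map label s <= L} ->
  \big[addb/false]_(v <- L) odd (count (fun p => label p == v) s) = odd (size s).
Proof.
move=> uL; elim: s => [|p s IH] sub; first by rewrite big1.
have e : \big[addb/false]_(v <- L) (label p == v) = true.
  rewrite (bigD1_seq (label p)) ?sub ?mem_head //= eqxx big1 // => v.
  by rewrite eq_sym => /negbTE.
have {}IH := IH (fun u us => sub u (@mem_behead _ (map label (p :: s)) u us)).
rewrite -[RHS]/(true (+) odd (size s)) -IH.
transitivity (\big[addb/false]_(v <- L) ((label p == v) (+) odd (count (fun p => label p == v) s))).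
  by apply: eq_bigr => v _; rewrite /= oddD oddb.
by rewrite big_split /= e.
Qed.

Lemma over_word_wf w v : wf_code w -> all (fun p => is_classical (kind p)) w ->
  over_word v w = [::] \/ exists o, over_word v w = [:: o; ~~ o].
Proof.
move=> wfw cl; rewrite /over_word; have [->|[k [d e]]] := wfw v; first by left.
right; exists (is_over k); rewrite e /=.
have : all (fun p => is_classical (kind p)) [seq p <- w | label p == v].
  by rewrite all_filter; apply: sub_all cl => p /= clp; rewrite clp implybT.
by rewrite e /=; case: k {e}.
Qed.

Lemma pair_word_cons a v p s : label p = a ->
  pair_word a v (p :: s) = (true, is_over (kind p)) :: pair_word a v s.
Proof. by move=> <-; rewrite /pair_word /= eqxx /= eqxx. Qed.

(* Moving an over-passage of [p] across the base point changes the count by the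
   number of chords interlaced with [p]. *)
Lemma arf_rot1 p w : wf_code (p :: w) -> all (fun q => is_classical (kind q)) (p :: w) ->
  gauss_even (p :: w) -> arf (p :: w) = arf (rcons w p).
Proof.
move=> wfw cl gw; set a := label p.
have [s [p' [y [ew [lp' kp']]]]] : exists s p' y, w = s ++ p' :: y /\ label p' = a /\
    kind p' = mate (kind p).
  have := wfw a; rewrite /= eqxx => -[//|[k [d [ep]]]].
  elim: w {wfw cl gw} => //= q w IH; case: (eqVneq (label q) a) => [lq [eq _]|_ /IH].
    by exists [::], q, w; rewrite lq eq ep.
  by case=> s [p' [y [-> h]]]; exists (q :: s), p', y.
have [ns ny] : a \notin map label s /\ a \notin map label y.
  have := wf_count a wfw; rewrite ew /= count_cat /= lp' eqxx.
  by move=> h; split; apply: count_label0; case: h; clear; lia.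
set L1 := undup (map label (s ++ y)).
have memL1 u : u \in L1 -> (u == a) = false.
  rewrite mem_undup map_cat mem_cat => h; apply/negbTE; apply: contraTneq h => ->.
  by rewrite negb_or ns ny.
apply: (@arf_diff (a :: L1)).
- by rewrite /= undup_uniq andbT mem_undup map_cat mem_cat negb_or ns ny.
- move=> u; rewrite ew /= map_cat /= !inE mem_undup map_cat !mem_cat inE lp' -/a.
  by case: (u == a) => //=; rewrite orbF.
- move=> u; rewrite ew map_rcons mem_rcons map_cat /= !inE mem_undup map_cat !mem_cat inE lp' -/a.
  by case: (u == a) => //=; rewrite orbF.
rewrite !big_cons !(arf_pair_neq _ erefl) addFb.
have low u v : u \in L1 -> v \in L1 -> arf_pair (p :: w) u v (+) arf_pair (rcons w p) u v = false.
  move=> /memL1 ua /memL1 va; rewrite /arf_pair -cats1 -cat1s !pair_word_cat.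
  rewrite (@pair_word_nil u v [:: p]) ?cats0 ?addbb //.
    by rewrite inE ua.
  by rewrite inE va.
rewrite [X in _ (+) X](eq_big_seq (fun u => arf_pair (p :: w) u a (+) arf_pair (rcons w p) u a)); last first.
  move=> u uL; rewrite big_cons [X in _ (+) X]big1_seq ?addbF // => v /= vL; exact: low.
rewrite -big_split /=.
(* With both orders of [a] and [v] taken together, the contribution changes iff [p] is an
   over-passage and [v] has exactly one passage in [s]. Summed over [v], this gives the parity of
   [size s], which is even. *)
have key v : v \in L1 ->
   arf_pair (p :: w) a v (+) arf_pair (rcons w p) a v (+) (arf_pair (p :: w) v a (+) arf_pair (rcons w p) v a)
   = is_over (kind p) && odd (count (fun q => label q == v) s).
  move=> /memL1 va.
  have cp : is_classical (kind p) by case/andP: cl.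
  have sv : count (fun q => label q == v) s = size (over_word v s) by rewrite size_map size_filter.
  have ov : over_word v s ++ over_word v y = [::] \/ exists o, over_word v s ++ over_word v y = [:: o; ~~ o].
    have av : (a == v) = false by rewrite eq_sym.
    by have := over_word_wf v wfw cl; rewrite ew /over_word /= av filter_cat /= lp' av map_cat.
  have overN : is_over (kind p') = ~~ is_over (kind p) by rewrite kp'; move: cp; case: (kind p).
  have w1 : pair_word a v (p :: w) = (true, is_over (kind p)) :: map (pair false) (over_word v s) ++
      (true, ~~ is_over (kind p)) :: map (pair false) (over_word v y).
    rewrite ew pair_word_cons // pair_word_cat pair_word_cons // -overN.
    by rewrite (pair_word_absent _ ns) (pair_word_absent _ ny).
  have w2 : pair_word a v (rcons w p) = map (pair false) (over_word v s) ++
      (true, ~~ is_over (kind p)) :: map (pair false) (over_word v y) ++ [:: (true, is_over (kind p))].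
    rewrite ew -cats1 -catA cat_cons pair_word_cat pair_word_cons // pair_word_cat pair_word_cons // -overN.
    by rewrite (pair_word_absent _ ns) (pair_word_absent _ ny).
  rewrite (@arf_pairC (p :: w) v a) ?va // (@arf_pairC (rcons w p) v a) ?va // w1 w2 sv.
  rewrite /arf_pair eq_sym va w1 w2 /=.
  case: ov => [|[o]].
    by case: (over_word v s) => //; case: (over_word v y) => //; case: (is_over _).
  case: (over_word v s) => [|? [|? [|? ?]]] //=; case: (over_word v y) => [|? [|? [|? ?]]] //=;
    by case=> *; subst; case: (is_over _); case: o.
rewrite (eq_big_seq _ key) -big_distrr /=.
rewrite sum_odd_count ?undup_uniq //; last first.
  by move=> u us; rewrite mem_undup map_cat mem_cat us.
have := gw [::] p s p' y; rewrite /= ew lp' => /(_ erefl erefl) /negbTE ->.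
exact: andbF.
Qed.

Lemma arf_rot w i : wf_code w -> all (fun q => is_classical (kind q)) w ->
  gauss_even w -> i <= size w -> arf (rot i w) = arf w.
Proof.
move=> wfw cl ge.
have wfr j : wf_code (rot j w) by apply: wf_cat; rewrite cat_take_drop.
elim: i => [|i IH] lti; first by rewrite rot0.
have gei : gauss_even (rot i w).
  elim: i {IH} lti => [|i IH] lti; first by rewrite rot0.
  rewrite rotS ?(ltnW lti) //; have := IH (ltnW lti); have := wf_even (wfr i).
  case: (rot i w) => //= p z; rewrite rot1_cons; exact: gauss_even_rot1.
rewrite -(IH (ltnW lti)) rotS ?(ltnW lti) //; symmetry.
have clr : all (fun q => is_classical (kind q)) (rot i w).
  by move: cl; rewrite -{1}(cat_take_drop i w) !all_cat andbC.
move: (wfr i) clr gei; case: (rot i w) => // p z; rewrite rot1_cons; exact: arf_rot1.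
Qed.

(** For a change of base point, planarity provides Gauss's parity condition. *)
Lemma arf_invariant D D' : classical_equiv D D' -> arf (code D) = arf (code D').
Proof.
elim=> [{}D {}D' [cD cD' h]|//|//|? ? ? _ -> _ -> //].
case: cD cD' => [[wfD plD] clD] [[wfD' plD'] clD'].
case: h => [[f w b injf|w b b' i0 i _ _|w b]|h] in wfD plD clD wfD' plD' clD' *.
- by rewrite /= arf_relabel.
- by rewrite /= arf_rot //; [exact: planar_gauss_even|exact: ltnW].
- by rewrite /= arf_rev.
case: h wfD wfD' {plD clD plD' clD'} => /=.
- by move=> b x y a l d _ wf; apply: arf_R1.
- by move=> b x y z a a' l d e _ wf; apply: arf_R2.
by move=> out x0 x1 x2 x3 a b c x e1 e2 e3 la lb lc acyc wf _; apply: arf_R3.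
Qed.

Lemma classical_unknot_arf D : classical_unknot D -> arf (code D) = false.
Proof. by case=> b /arf_invariant <-; rewrite /arf /arf_on big_nil. Qed.

(** * Interlaced precrossings *)

(** For distinct chords of a well-formed code, the value [[:: c; d; c; d]] means that they are
    interlaced, [c] being met first. *)
Definition pair_labels c d w := [seq label p | p <- w & (label p == c) || (label p == d)].

(** As in [resolve], [theta] gives the signs of the crossings: a passage is over iff [theta] agrees
    with [from_right]. *)
Definition resolution (theta : nat -> bool) (p : passage) :=
  Passage (label p) (level (theta (label p) == from_right p)) (from_right p).

Lemma pair_word_resolution u v theta w : pair_word u v (map (resolution theta) w) =
  [seq (label p == u, theta (label p) == from_right p) | p <- w & (label p == u) || (label p == v)].
Proof.
rewrite /pair_word filter_map -map_comp; apply: eq_map => p /=.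
by rewrite is_over_level.
Qed.

Lemma pair_word_resolution_ext u v theta theta' w : theta u = theta' u -> theta v = theta' v ->
  pair_word u v (map (resolution theta) w) = pair_word u v (map (resolution theta') w).
Proof.
move=> eu ev; rewrite !pair_word_resolution; elim: w => //= p w IH.
by case: ifP => //= /orP[]/eqP ->; rewrite IH ?eu ?ev.
Qed.

(* Summing [arf] over the four resolutions of [c] and [d] kills all pairs of
   chords but [{c, d}], which contributes exactly once if interlaced. *)
Lemma unknotted_not_interlaced w c d (sigma : nat -> bool) : wf_code w ->
  (forall theta, (forall x, x != c -> x != d -> theta x = sigma x) ->
     arf (map (resolution theta) w) = false) ->
  c != d -> pair_labels c d w <> [:: c; d; c; d].
Proof.
move=> wfw unk ncd inter.
pose th s t x := if x == c then s else if x == d then t else sigma x.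
pose F s t := arf_pair (map (resolution (th s t)) w).
pose L := undup (map label w).
have arfF s t : arf_on L (map (resolution (th s t)) w) = false.
  rewrite -arfE ?undup_uniq //; first by apply: unk => x /negbTE xc /negbTE xd; rewrite /th xc xd.
  by move=> x; rewrite -map_comp mem_undup.
have [cL dL] : c \in L /\ d \in L.
  have sub x : x \in pair_labels c d w -> x \in L.
    rewrite mem_undup /pair_labels; elim: (w) => //= p w' IH; rewrite inE.
    by case: ifP => _ /=; rewrite ?inE; [case: eqP => //= _ /IH ->|move=> /IH ->; rewrite orbT].
  by rewrite !sub // inter !inE eqxx ?orbT.
have thc s t : th s t c = s by rewrite /th eqxx.
have thd s t : th s t d = t by rewrite /th eq_sym (negbTE ncd) eqxx.
have Fc u v s s' t : u != c -> v != c -> F s t u v = F s' t u v.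
  by move=> /negbTE uc /negbTE vc;
    rewrite /F /arf_pair (@pair_word_resolution_ext u v _ (th s' t)) // /th ?uc ?vc.
have Fd u v s t t' : u != d -> v != d -> F s t u v = F s t' u v.
  by move=> /negbTE ud /negbTE vd;
    rewrite /F /arf_pair (@pair_word_resolution_ext u v _ (th s t')) // /th ?ud ?vd.
(* The second difference with respect to the signs of [c] and [d]. It vanishes for a pair missing
   [c] or [d], which is insensitive to the corresponding sign. *)
pose G u v := F true true u v (+) F true false u v (+) (F false true u v (+) F false false u v).
have G0 u v : ~~ ((u \in [:: c; d]) && (v \in [:: c; d])) -> G u v = false.
  rewrite /G; case: (boolP ((u == d) || (v == d))) => [|nd _]; last first.
    move: nd; rewrite negb_or => /andP[ud vd].
    by rewrite !(@Fd u v _ true false) // !addbb.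
  case: (boolP ((u == c) || (v == c))) => [|nc _ _]; last first.
    move: nc; rewrite negb_or => /andP[uc vc].
    by rewrite !(@Fc u v true false) // addbb.
  rewrite !inE; case: (eqVneq u c) => [->|_ /= /eqP ->]; rewrite (negbTE ncd) /=.
    by move=> _ ->; rewrite orbT.
  by rewrite orbF eqxx => ->.
have : \big[addb/false]_(u <- L) \big[addb/false]_(v <- L) G u v = false.
  transitivity (arf_on L (map (resolution (th true true)) w) (+)
     arf_on L (map (resolution (th true false)) w) (+)
     (arf_on L (map (resolution (th false true)) w) (+)
     arf_on L (map (resolution (th false false)) w))); last by rewrite !arfF.
  rewrite /arf_on -!big_split; apply: eq_bigr => u _ /=.
  by rewrite -!big_split; apply: eq_bigr => v _.
rewrite (@sum2_support L [:: c; d]) ?undup_uniq //; first last.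
- by move=> x; rewrite !inE => /orP[]/eqP ->.
- by rewrite /= inE ncd.
rewrite !big_cons !big_nil.
have [f1 [f2 wE]] : exists f1 f2, forall s t, pair_word c d (map (resolution (th s t)) w) =
    [:: (true, s == f1); (false, t == f2); (true, s == ~~ f1); (false, t == ~~ f2)].
  have := inter; rewrite /pair_labels; set X := filter _ w => eX.
  have [Xc Xd] : [seq p <- X | label p == c] = [seq p <- w | label p == c] /\
     [seq p <- X | label p == d] = [seq p <- w | label p == d].
    by rewrite -!filter_predI; split; apply: eq_filter => p /=; case: eqP; rewrite ?orbT.
  have wX s t : pair_word c d (map (resolution (th s t)) w) =
     [seq (label p == c, th s t (label p) == from_right p) | p <- X] by rewrite pair_word_resolution.
  move: eX Xc Xd wX; case: X => [|p1 [|p2 [|p3 [|p4 [|]]]]] //= [l1 l2 l3 l4].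
  rewrite l1 l2 l3 l4 !eqxx ![d == _]eq_sym (negbTE ncd) /= => Xc Xd wX.
  exists (from_right p1), (from_right p2) => s t; rewrite wX thc thd.
  have := wfw c; rewrite -Xc => -[//|[k [e [-> ->]]]] /=.
  by have := wfw d; rewrite -Xd => -[//|[k' [e' [-> ->]]]] /=.
have ndc : d != c by rewrite eq_sym.
have Gcc : G c c = false by rewrite /G /F !(arf_pair_neq _ erefl).
have Gdd : G d d = false by rewrite /G /F !(arf_pair_neq _ erefl).
(* The word of the pair starts with [c], while the pattern for the ordered pair [d], [c] starts with
   [d]. *)
have Gdc : G d c = false.
  by rewrite /G /F /arf_pair ndc !(pair_word_sym _ ncd) !wE /=.
(* The pattern requires [s = f1] and [t = ~~ f2], so exactly one of the four resolutions counts. *)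
have -> : G c d = true.
  by rewrite /G /F /arf_pair ncd !wE; case: f1 {wE}; case: f2.
by rewrite Gcc Gdd Gdc.
Qed.

(** * Unknotting by detours *)

Definition nested w := forall c d, c != d ->
  c \in [seq label p | p <- w & is_classical (kind p)] ->
  d \in [seq label p | p <- w & is_classical (kind p)] ->
  pair_labels c d w <> [:: c; d; c; d].

Lemma map_filter_nth (P : pred passage) w i : i < size w -> P (nth p0 w i) ->
  lab w i \in [seq label p | p <- w & P p].
Proof.
elim: w i => //= p w IH [|i] lti Pi; first by rewrite /= in Pi; rewrite Pi mem_head.
by case: ifP => _; rewrite ?inE (IH i) ?orbT.
Qed.

(** The positions selected by the filter and [[:: i1; i2; i3; i4]] are strictly increasing lists
    with the same elements. *)
Lemma pair_labels_pos w i1 i2 i3 i4 : wf_code w -> i1 < i2 -> i2 < i3 -> i3 < i4 -> i4 < size w ->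
  lab w i1 = lab w i3 -> lab w i2 = lab w i4 ->
  let c := lab w i1 in let d := lab w i2 in pair_labels c d w = [:: c; d; c; d].
Proof.
move=> wfw l12 l23 l34 l4 e13 e24 c d.
have l3 := ltn_trans l34 l4; have l2 := ltn_trans l23 l3; have l1 := ltn_trans l12 l2.
rewrite /pair_labels -[X in filter _ X](mkseq_nth p0 w) /mkseq filter_map -map_comp.
set I := [seq i <- iota 0 (size w) | _].
suff -> : I = [:: i1; i2; i3; i4] by rewrite /= -!/(lab w _) -e13 -e24.
apply: (irr_sorted_eq ltn_trans ltnn).
- by apply: sorted_filter; [exact: ltn_trans | exact: iota_ltn_sorted].
- by rewrite /= l12 l23 l34.
move=> i; rewrite mem_filter mem_iota add0n /= -!/(lab w _) !inE.
apply/andP/idP => [[h lti]|]; last first.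
  by case/or4P => /eqP ->; rewrite ?l1 ?l2 ?l3 ?l4 -?e13 -?e24 /c /d eqxx ?orbT.
have uni a b : a < size w -> b < size w -> a < b -> lab w a = lab w b -> lab w i = lab w a ->
    (i == a) || (i == b).
  move=> lta ltb ltab lab_ab li; have [j [_ _ [_ _ _ u]]] := wf_pos wfw lta.
  by have := u b ltb (esym lab_ab); rewrite gtn_eqF //= => /eqP ->; exact: u.
case/orP: h => /eqP h.
  by case/orP: (uni _ _ l1 l3 (ltn_trans l12 l23) e13 h) => ->; rewrite ?orbT.
by case/orP: (uni _ _ l2 l4 (ltn_trans l23 l34) e24 h) => ->; rewrite ?orbT.
Qed.

(** A classical chord with the fewest passages between its ends is taken. *)
Lemma innermost w : wf_code w -> nested w -> ~~ all (fun p => is_virtual (kind p)) w ->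
  all (fun p => ~~ is_pre (kind p)) w ->
  exists x p s p' y, [/\ w = x ++ p :: s ++ p' :: y, label p = label p', is_classical (kind p)
     & all (fun p => is_virtual (kind p)) s].
Proof.
move=> wfw nw; set n := size w.
pose cl i := is_classical (kind (nth p0 w i)).
(* Some classical chord has exactly [m] passages between its ends. *)
pose P m := `[< exists i, [/\ i + m.+1 < n, lab w i = lab w (i + m.+1) & cl i] >].
move=> nv np.
have clN i : i < n -> ~~ cl i -> is_virtual (kind (nth p0 w i)).
  move=> lti; rewrite /cl; have : ~~ is_pre (kind (nth p0 w i)) by apply: (all_nthP p0 np).
  by case: (kind _).
have clmate i j : i < n -> j < n -> i != j -> lab w i = lab w j -> cl i -> cl j.
  move=> lti ltj nij lij; have [j' [_ nj' [_ _ k' u]]] := wf_pos wfw lti.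
  have := u j ltj (esym lij); rewrite eq_sym (negbTE nij) /= => /eqP ->.
  by rewrite /cl k'; case: (kind _).
have mate i : i < n -> cl i -> exists j, [/\ j < n, i != j, lab w i = lab w j & cl j].
  move=> lti ci; have [j [ltj nj [lj _ _ _]]] := wf_pos wfw lti.
  by exists j; split; rewrite // 1?eq_sym //; apply: (clmate i); rewrite // eq_sym.
have Pij i j : i < j -> j < n -> lab w i = lab w j -> cl i -> P (j - i).-1.
  move=> ltij ltj lij ci; apply/asboolP; exists i.
  by have -> : i + (j - i).-1.+1 = j by lia.
have exP : exists m, P m.
  have [i lti ci] : exists2 i, i < n & cl i.
    move: nv; rewrite -has_predC => /(has_nthP p0)[i lti vi]; exists i => //.
    by apply: contraNT vi; exact: clN.
  have [j [ltj nij lij cj]] := mate i lti ci.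
  case: (ltngtP i j) nij => // ltij _; first by exists (j - i).-1; exact: Pij.
  by exists (i - j).-1; apply: Pij.
have [m /asboolP[i [ltm lim ci]] minm] := ex_minnP exP.
set j := i + m.+1 in ltm lim; have ltij : i < j by rewrite /j; lia.
have lti := ltn_trans ltij ltm.
have cj : cl j by apply: (clmate i); rewrite // neq_ltn ltij.
have memc k : k < n -> cl k -> lab w k \in [seq label p | p <- w & is_classical (kind p)].
  by move=> ltk ck; apply: map_filter_nth.
(* The partner of a classical passage inside the minimal chord would lie inside too, giving a
   shorter chord, or outside, giving two interlaced chords. *)
have inside k : i < k -> k < j -> ~~ cl k.
  move=> ik kj; apply/negP => ck; have ltk := ltn_trans kj ltm.
  have [k' [ltk' nkk lkk ck']] := mate k ltk ck.
  have nlik : lab w i != lab w k.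
    apply/eqP => lik; have [j' [_ _ [_ _ _ u]]] := wf_pos wfw lti.
    have := u k ltk (esym lik); rewrite gtn_eqF //= => /eqP ek.
    have := u j ltm (esym lim); rewrite gtn_eqF //= => /eqP ej.
    by move: kj; rewrite ek ej ltnn.
  have [lt1|gt1|e1] := ltngtP k' i.
  - apply: (nw (lab w k') (lab w i)); rewrite ?memc // -?lkk 1?eq_sym //.
    rewrite lkk; exact: (@pair_labels_pos w k' i k j).
  - have [lt2|gt2|e2] := ltngtP k' j.
    + have [lt3|gt3|e3] := ltngtP k k'; last by rewrite e3 eqxx in nkk.
      * by have := minm _ (Pij _ _ lt3 ltk' lkk ck); rewrite /j in lt2 *; lia.
      * by have := minm _ (Pij _ _ gt3 ltk (esym lkk) ck'); rewrite /j in kj; lia.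
    + by apply: (nw (lab w i) (lab w k)); rewrite ?memc //; apply: (@pair_labels_pos w i k j k').
    + by move: nlik; rewrite lim lkk e2 eqxx.
  - by move: nlik; rewrite lkk e1 eqxx.
exists (take i w), (nth p0 w i), (take m (drop i.+1 w)), (nth p0 w j), (drop j.+1 w); split => //.
  rewrite -{1}(cat_take_drop i w) (drop_nth p0 lti) -{1}(cat_take_drop m (drop i.+1 w)) drop_drop.
  have -> : m + i.+1 = j by rewrite /j; lia.
  by rewrite (drop_nth p0 ltm).
apply/(all_nthP p0) => k; rewrite size_take size_drop => ltk.
have ltkm : k < m by move: ltk; case: ifP; lia.
rewrite nth_take // nth_drop; apply: clN; [|apply: inside]; rewrite /j /n in ltm *; lia.
Qed.

Lemma wf_filter (K : pred nat) w : wf_code w -> wf_code [seq p <- w | K (label p)].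
Proof.
move=> wfw c; rewrite -filter_predI; case Kc: (K c).
  rewrite (eq_filter (a2 := fun p => label p == c)); first exact: wfw.
  by move=> p /=; case: eqP => //= ->.
left; rewrite (eq_filter (a2 := pred0)) ?filter_pred0 // => p /=.
by case: eqP => //= ->.
Qed.

Lemma nested_filter (K : pred nat) w : nested w -> nested [seq p <- w | K (label p)].
Proof.
move=> nw c d ncd.
have mem x : x \in [seq label p | p <- [seq p <- w | K (label p)] & is_classical (kind p)] ->
    K x /\ x \in [seq label p | p <- w & is_classical (kind p)].
  elim: (w) => //= p w' IH; case Kp: (K _) => /=; case: (is_classical _) => //=; rewrite ?inE.
  - by case/predU1P=> [->|/IH[-> ->]]; rewrite ?eqxx ?orbT.
  - by move/IH=> [-> ->]; rewrite orbT.
move=> /mem[Kc cw] /mem[Kd dw]; rewrite /pair_labels -filter_predI.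
rewrite (eq_filter (a2 := fun p => (label p == c) || (label p == d))); first exact: nw.
by move=> p /=; case: orP => //= -[]/eqP ->.
Qed.

Lemma filter_notin_cons a S s : a \notin map label s ->
  [seq q <- s | label q \notin a :: S] = [seq q <- s | label q \notin S].
Proof.
elim: s => //= q s IH; rewrite inE negb_or eq_sym => /andP[/negbTE na /IH e].
by rewrite inE na /= e.
Qed.

Lemma filter_labels_nil s (S : seq nat) : {subset map label s <= S} -> [seq q <- s | label q \notin S] = [::].
Proof.
elim: s => //= q s IH sub; rewrite sub ?mem_head //=; apply: IH => u us.
by apply: sub; rewrite inE us orbT.
Qed.

Lemma all_filter_sub (T : Type) (P K : pred T) s : all P s -> all P (filter K s).
Proof. by move=> h; rewrite all_filter; apply: sub_all h => x /= ->; rewrite implybT. Qed.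

(** Induction on a bound [n] of the length. From the shorter code [x' ++ y'], a first Reidemeister
    move creates the kink [p], [p'], and a detour stretches it into the loop of [w]. *)
Lemma nested_virtual_unknot n w o : size w <= n -> virtual_diagram (Diagram w o) -> nested w ->
  virtual_unknot (Diagram w o).
Proof.
elim: n w => [|n IH] w; first by rewrite leqn0 => /nilP -> _ _; exists o; apply: rst_refl.
move=> szw vd nw; have [[/= wfw plw] npw] := vd.
case: (boolP (all (fun p => is_virtual (kind p)) w)) => [vw|nvw].
  (* The whole curve is one virtual strand, which a single detour exchanges with the empty
     strand. *)
  exists o; apply: rst_step; split => //; first by split => //; split=> [c|]; left.
  apply: Or33; have := @Detour o [::] [::] [::] [::] w [::].
  by rewrite !cat0s cats0; apply.
have [x [p [s [p' [y [ew lpp cp vs]]]]]] := innermost wfw nw nvw npw.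
have bw := (planar_bounding wfw).1 plw.
(* The double points of [s] may have their other passage in [x] or [y]; these passages go away with
   the loop. *)
set x' := erase s x; set y' := erase s y.
have cnt := wf_count (label p) wfw; rewrite ew !count_cat /= count_cat /= -lpp eqxx in cnt.
have [px ps py] : [/\ label p \notin map label x, label p \notin map label s &
    label p \notin map label y].
  by split; apply: count_label0; case: cnt; clear; lia.
have e1 : [seq q <- w | label q \notin map label s] = x' ++ [:: p; p'] ++ y'.
  rewrite ew filter_cat /= (negbTE ps) /= filter_cat /= -lpp (negbTE ps) /=.
  by rewrite (filter_labels_nil (s := s)).
have e2 : [seq q <- w | label q \notin map label (p :: s)] = x' ++ y'.
  rewrite ew filter_cat -cat_cons filter_cat (filter_labels_nil (s := p :: s)) //.
  by rewrite /= -lpp inE eqxx /= !filter_notin_cons.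
have wf1 : wf_code (x' ++ [:: p; p'] ++ y').
  by rewrite -e1; apply: (@wf_filter (fun c => c \notin map label s)).
have wf2 : wf_code (x' ++ y').
  by rewrite -e2; apply: (@wf_filter (fun c => c \notin map label (p :: s))).
have b2 : bounding (x' ++ y').
  by have := @bounding_erase_loop x p s p' y; rewrite /= -ew -/(map label (p :: s)) e2; apply.
(* Planarity of the kinked code is obtained from below: the whole loop is deleted first, then a kink
   is inserted. *)
have b1 : bounding (x' ++ [:: p; p'] ++ y') by apply: bounding_kink.
have vd1 : virtual_diagram (Diagram (x' ++ [:: p; p'] ++ y') o).
  split; first by split; last exact/(planar_bounding wf1).
  by rewrite /= -e1; apply: all_filter_sub.
have vd2 : virtual_diagram (Diagram (x' ++ y') o).
  split; first by split; last exact/(planar_bounding wf2).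
  by rewrite /= -e2; apply: all_filter_sub.
have n2 : nested (x' ++ y').
  by rewrite -e2; apply: (@nested_filter (fun c => c \notin map label (p :: s))).
have sz2 : size (x' ++ y') <= n.
  have : size [seq q <- w | label q \notin map label (p :: s)] < size w.
    rewrite e2 ew !size_cat /= size_cat /= !size_filter.
    have := count_size (fun q => label q \notin map label s) x.
    by have := count_size (fun q => label q \notin map label s) y; lia.
  by rewrite e2 => lt; rewrite -ltnS (leq_trans lt).
have [b eb] := IH _ sz2 vd2 n2.
exists b; apply: (rst_trans _ _ _ _ _ eb); apply: (rst_trans _ _ _ (Diagram (x' ++ [:: p; p'] ++ y') o)).
  apply: rst_step; split => //; apply: Or32.
  have := wfw (label p); rewrite ew filter_cat /= eqxx filter_cat /= -lpp eqxx.
  have nil z : label p \notin map label z -> [seq q <- z | label q == label p] = [::].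
    elim: z => //= q z IHz; rewrite inE negb_or eq_sym => /andP[/negbTE -> /IHz ->] //.
  rewrite !nil //= => -[//|[k [d [ep ep']]]].
  have := cp; rewrite ep ep' /=; case: (k) => // _; first exact: (@R1 o x' y' _ true d).
  exact: (@R1 o x' y' _ false d).
apply: rst_sym; apply: rst_step; split => //; apply: Or33.
(* The strand [s] between [p] and [p'] is replaced by the empty strand. *)
have := @Detour o (rcons x p) s (p' :: y) (rcons x' p) [::] (p' :: y').
have er0 z : erase [::] z = z by exact: filter_predT.
rewrite !cat_rcons -ew !er0; apply => //.
  by rewrite /erase filter_rcons ps.
by rewrite /erase /= -lpp ps.
Qed.

(** * Minima, and passage from trivializing sets to virtual unknotting sets *)

Lemma minimum_le (P : nat -> Prop) n : P n -> exists m, [/\ minimum P = Some m, m <= n & P m].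
Proof.
move=> Pn; rewrite /minimum; case: pselect => [h|[]]; last by exists n; apply/asboolP.
case: ex_minnP => m /asboolP Pm minm; exists m; split => //; apply: minm; exact/asboolP.
Qed.

Lemma minimum_some (P : nat -> Prop) n : minimum P = Some n -> P n.
Proof.
rewrite /minimum; case: pselect => // h [<-].
by case: ex_minnP => m /asboolP.
Qed.

(** Stated as an equivalence because reflexivity relates every diagram to itself, classical or
    not. *)
Lemma classical_equiv_diagram D D' : classical_equiv D D' -> classical_diagram D <-> classical_diagram D'.
Proof.
by elim=> [? ? []|//|? ? _ ->|? ? ? _ -> _ ->].
Qed.

(** Cycles and colourings depend on labels and directions, not on the kinds of the crossings. *)
Lemma bounding_map f w : (forall p, label (f p) = label p) ->
  (forall p, from_right (f p) = from_right p) -> bounding w -> bounding (map f w).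
Proof.
move=> lf df bw g [g0 gf].
have labE k : k < size w -> lab (map f w) k = lab w k by move=> ltk; rewrite /lab (nth_map p0).
have dirE k : k < size w -> dir (map f w) k = dir w k by move=> ltk; rewrite /dir (nth_map p0).
rewrite size_map in g0 gf.
have [|L [L0 LE]] := bw g.
  by split=> // k j ltk ltj nkj lkj; apply: gf; rewrite ?labE.
exists L; split; rewrite size_map // => k j ltk ltj nkj.
by rewrite !labE // dirE //; apply: LE.
Qed.

(** The chords that stay classical are those outside [A], so the virtualized code is [nested];
    planarity is kept since only kinds change. *)
Lemma virtualize_unknot D (A : seq nat) : classical_diagram D ->
  (forall c d, c != d -> c \notin A -> d \notin A -> pair_labels c d (code D) <> [:: c; d; c; d]) ->
  virtual_unknot (virtualize A D).
Proof.
case=> -[wfD plD] clD ni.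
set f := fun p => if label p \in A then Passage (label p) Virtual (from_right p) else p.
have lf p : label (f p) = label p by rewrite /f; case: ifP.
have df p : from_right (f p) = from_right p by rewrite /f; case: ifP.
have wf : wf_code (map f (code D)).
  move=> c; rewrite filter_map (eq_filter (a2 := fun p => label p == c)); last by move=> p /=; rewrite lf.
  case: (wfD c) => [->|[k [d ->]]]; [by left | right].
  by rewrite /= /f /=; case: ifP => _; [exists Virtual, d | exists k, d].
apply: (@nested_virtual_unknot (size (map f (code D)))) => //.
  split; last first.
    rewrite /= all_map; apply: sub_all clD => p /=; rewrite -/(f p) /f; case: ifP => // _.
    by case: (kind p).
  split => //; apply/(planar_bounding wf); apply: bounding_map => //.
  exact/(planar_bounding wfD).
have mem x : x \in [seq label p | p <- map f (code D) & is_classical (kind p)] -> x \notin A.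
  rewrite filter_map -map_comp; elim: (code D) => //= p w IH.
  case: ifP => //=; rewrite inE lf {1}/f; case: ifP => //= pA _ /predU1P[->|//].
  by rewrite pA.
move=> c d ncd /mem cA /mem dA; have := ni c d ncd cA dA.
suff -> : pair_labels c d (map f (code D)) = pair_labels c d (code D) by [].
rewrite /pair_labels filter_map -map_comp (eq_map (g := label)) //; congr map.
by apply: eq_filter => p; rewrite -[LHS]/((label (f p) == c) || (label (f p) == d)) lf.
Qed.

(** With [c] and [d] outside [A], a full resolution equal to [sigma] elsewhere extends the given
    resolution of [A], hence is unknotted and has zero Arf invariant. *)
Lemma trivializing_not_interlaced D A sigma : classical_diagram D ->
  necessarily_unknotted (resolve A sigma (shadow D)) ->
  forall c d, c != d -> c \notin A -> d \notin A -> pair_labels c d (code D) <> [:: c; d; c; d].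
Proof.
case=> -[wfD plD] clD unk c d ncd cA dA.
apply: (@unknotted_not_interlaced _ _ _ sigma) => // theta th.
have thA x : x \in A -> theta x = sigma x.
  by move=> xA; apply: th; apply: contraTneq xA => ->.
rewrite -(classical_unknot_arf (unk theta)); congr arf.
set P := resolve A sigma (shadow D).
(* Every label outside [A] is still a precrossing of [P], so resolving all of them by [theta] gives
   the complete resolution. *)
have : forall x, x \in map label (code D) -> x \notin A -> x \in precrossings P.
  move=> x; rewrite /precrossings mem_undup /=; elim: (code D) => //= p w IH; rewrite inE.
  case: (boolP (label p \in A)) => pA /=.
    have -> : is_pre (level (sigma (label p) == from_right p)) = false by case: (_ == _).
    by case/predU1P=> [-> /negP //|/IH].
  by case/predU1P=> [->|xw /(IH xw) xP]; rewrite inE ?eqxx ?xP ?orbT.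
rewrite /P /=; move: (precrossings _) => S; elim: (code D) => //= p w IH sub.
rewrite IH => [|x xw]; last by apply: sub; rewrite inE xw orbT.
congr cons; rewrite /resolution; case: (boolP (label p \in A)) => pA /=.
  by rewrite thA //; case: (_ == _).
by rewrite sub ?mem_head.
Qed.

Theorem theorem7p5 (K : diagram -> Prop) (hK : classical_knot K) :
  le_inf (uv (as_virtual K)) (tr K).
Proof.
have [D0 cD0 KE] := hK.
case E : (tr K) => [n|]; last by case: (uv _).
have [D KD /minimum_some[A [sigma [uA sA szA unk]]]] := minimum_some E.
have cD : classical_diagram D by apply/(classical_equiv_diagram (iffLR (KE D) KD)).
(* The same set [A] serves on both sides: first as precrossings of the shadow, then as classical
   crossings of [D]. *)
have crossE : precrossings (shadow D) =i classical_crossings D.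
  move=> x; rewrite /precrossings /classical_crossings !mem_undup.
  case: cD => _; rewrite /= filter_map -map_comp; elim: (code D) => //= p w IH /andP[-> clw].
  by rewrite /= !inE IH.
have [m [Em lemn _]] : exists m, [/\ uv_diagram D = Some m, m <= n & exists A0 : seq nat,
    [/\ uniq A0, {subset A0 <= classical_crossings D}, size A0 = m & virtual_unknot (virtualize A0 D)]].
  apply: minimum_le; exists A; split => //; first by move=> x /sA; rewrite crossE.
  exact: virtualize_unknot cD (trivializing_not_interlaced cD unk).
(* [D] is one of the virtual diagrams of the knot, so its own value bounds the minimum from
   above. *)
have [|k [Ek lekm _]] := @minimum_le (fun n => exists2 D, as_virtual K D & uv_diagram D = Some n) m.
  by exists D => //; exists D => //; apply: rst_refl.
by rewrite /uv Ek; exact: leq_trans lekm lemn.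
Qed.
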